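(* There exists a unique collection $\{\mathbb{D}_n\}_{n\ge0}$ of linear endomorphisms $\mathbb{D}_n$ of $C(\mathcal{G}_n^F)$ such that: (i) $\mathbb{D}_0=\mathrm{id}_{\mathbb{C}}$, and for all positive integers $n_1,n_2$ and all $f_i\in C(\mathcal{G}_{n_i}^F)$, $\mathbb{D}_{n_1+n_2}\big(R^{n_1+n_2}_{n_1,n_2}(f_1\boxtimes f_2)\big)=R^{n_1+n_2}_{n_1,n_2}\big(\mathbb{D}_{n_1}(f_1)\boxtimes\mathbb{D}_{n_2}(f_2)\big)$; (ii) for all $n\ge1$, $\mathbb{D}_n(f)=(-1)^{n-1}f$ for every pre-cuspidal $f\in C(\mathcal{G}_n^F)$.
   Context: Let $q$ be a prime power, $\mathcal{G}_n^F=\mathfrak{gl}_n(\mathbb{F}_q)$, $G_n^F=\mathrm{GL}_n(\mathbb{F}_q)$, and $C(\mathcal{G}_n^F)$ the complex functions on $\mathfrak{gl}_n(\mathbb{F}_q)$ invariant under $G_n^F$-conjugation ($C(\mathcal{G}_0^F)=\mathbb{C}$). View $\mathfrak{gl}_{n_1}\times\mathfrak{gl}_{n_2}$ as the block-diagonal matrices $\mathcal{L}_{n_1,n_2}$ in $\mathfrak{gl}_{n_1+n_2}$, $P$ the corresponding block upper triangular parabolic with Lie algebra $\mathcal{P}$, projection $\pi:\mathcal{P}\to\mathcal{L}_{n_1,n_2}$; Harish-Chandra induction is $R^{n}_{n_1,n_2}(\phi)(x)=\frac{1}{|P^F|}\sum_{g\in G_n^F,\,gxg^{-1}\in\mathcal{P}^F}\phi(\pi(gxg^{-1}))$,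 where $n=n_1+n_2$ and $f_1\boxtimes f_2$ is the external product. For a standard parabolic $P=L\ltimes U_P$, Harish-Chandra restriction is ${}^*R^{\mathcal{G}_n}_{\mathcal{L}}(f)(x)=\frac{1}{|U_P^F|}\sum_{y\in\mathcal{U}_P^F}f(x+y)$. A function $f\in C(\mathcal{G}_n^F)$ is pre-cuspidal if ${}^*R^{\mathcal{G}_n}_{\mathcal{L}}(f)=0$ for every Lie algebra $\mathcal{L}$ of an $F$-stable Levi subgroup of an $F$-stable proper parabolic subgroup of $\mathrm{GL}_n$. *)

(* Defs.v *)
From HB Require Import structures.
From mathcomp Require Import all_boot all_order all_algebra.
From mathcomp Require Export complex.
From mathcomp Require Import Rstruct.
Set Implicit Arguments. Unset Strict Implicit. Unset Printing Implicit Defensive.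
Import Order.TTheory GRing.Theory Num.Theory.
Local Open Scope ring_scope.

Definition CC : numClosedFieldType := (Rdefinitions.R)[i].

Section Defs.
Variable F : finFieldType.

Definition classfun (n : nat) (f : 'M[F]_n -> CC) : Prop :=
  forall g : 'M[F]_n, g \in unitmx -> forall x : 'M[F]_n,
    f (g *m x *m invmx g) = f x.

(* Harish-Chandra induction R^{n1+n2}_{n1,n2}(f1 [x] f2).
   P = block upper triangular parabolic, Lie P = block upper triangular
   matrices (lower-left block zero), pi = projection to the diagonal blocks. *)
Definition inLieP (n1 n2 : nat) (y : 'M[F]_(n1 + n2)) : bool :=
  dlsubmx y == 0.

Definition HCind (n1 n2 : nat) (f1 : 'M[F]_n1 -> CC) (f2 : 'M[F]_n2 -> CC)
    (x : 'M[F]_(n1 + n2)) : CC :=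
  (#|[set g : 'M[F]_(n1 + n2) | (g \in unitmx) && inLieP g]|%:R)^-1 *
  \sum_(g : 'M[F]_(n1 + n2) |
          (g \in unitmx) && inLieP (g *m x *m invmx g))
     (f1 (ulsubmx (g *m x *m invmx g)) * f2 (drsubmx (g *m x *m invmx g))).

(* Standard parabolic / Levi of GL_n attached to a composition of n, encoded
   by a nondecreasing block-index function blk : 'I_n -> nat (index i lies in
   block blk i).  Lie L = block diagonal, Lie U_P = strictly block upper
   triangular. The parabolic is proper iff blk is nonconstant. *)
Definition inLieL (n : nat) (blk : 'I_n -> nat) (x : 'M[F]_n) : bool :=
  [forall i, forall j, (blk i != blk j) ==> (x i j == 0)].

Definition inLieU (n : nat) (blk : 'I_n -> nat) (y : 'M[F]_n) : bool :=
  [forall i, forall j, ~~ (blk i < blk j)%N ==> (y i j == 0)].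

Definition std_block (n : nat) (blk : 'I_n -> nat) : Prop :=
  forall i j : 'I_n, (i <= j)%N -> (blk i <= blk j)%N.

Definition proper_block (n : nat) (blk : 'I_n -> nat) : Prop :=
  exists i j : 'I_n, blk i != blk j.

(* Harish-Chandra restriction to Lie(L') where (P', L') = g (P, L) g^-1,
   evaluated at the point g x g^-1 of Lie(L')^F (x in Lie(L)^F):
   1/|U_P'^F| sum_{y' in Lie(U_P')^F} f(g x g^-1 + y'),
   with y' = g y g^-1, y in Lie(U_P)^F. *)
Definition HCres (n : nat) (blk : 'I_n -> nat) (g : 'M[F]_n)
    (f : 'M[F]_n -> CC) (x : 'M[F]_n) : CC :=
  (#|[set y : 'M[F]_n | inLieU blk y]|%:R)^-1 *
  \sum_(y : 'M[F]_n | inLieU blk y) f (g *m (x + y) *m invmx g).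

(* Pre-cuspidal: all Harish-Chandra restrictions to Lie algebras of F-stable
   Levi subgroups of F-stable proper parabolics vanish.  These pairs (P', L')
   are exactly the GL_n(F)-conjugates of standard pairs (P, L). *)
Definition precuspidal (n : nat) (f : 'M[F]_n -> CC) : Prop :=
  forall (blk : 'I_n -> nat) (g : 'M[F]_n),
    std_block blk -> proper_block blk -> g \in unitmx ->
    forall x : 'M[F]_n, inLieL blk x -> HCres blk g f x = 0.

Definition is_endo_family (D : forall n : nat, ('M[F]_n -> CC) -> ('M[F]_n -> CC))
  : Prop :=
  forall n : nat,
    (forall f, classfun f -> classfun (D n f)) /\
    (forall (a : CC) f h, classfun f -> classfun h ->
       forall x, D n (fun z => a * f z + h z) x = a * D n f x + D n h x).

Definition D_props (D : forall n : nat, ('M[F]_n -> CC) -> ('M[F]_n -> CC))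
  : Prop :=
  is_endo_family D /\
  (forall f : 'M[F]_0 -> CC, classfun f -> forall x, D 0%N f x = f x) /\
  (forall (n1 n2 : nat), (0 < n1)%N -> (0 < n2)%N ->
     forall (f1 : 'M[F]_n1 -> CC) (f2 : 'M[F]_n2 -> CC),
       classfun f1 -> classfun f2 ->
       forall x : 'M[F]_(n1 + n2),
         D (n1 + n2)%N (HCind f1 f2) x = HCind (D n1 f1) (D n2 f2) x) /\
  (forall n : nat, (1 <= n)%N ->
     forall f : 'M[F]_n -> CC, classfun f -> precuspidal f ->
       forall x, D n f x = (-1) ^+ n.-1 * f x).

End Defs.

(* Main.v *)
Require Import Defs.
From mathcomp Require Import all_boot all_order all_algebra boolp.
Set Implicit Arguments. Unset Strict Implicit. Unset Printing Implicit Defensive.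
Import GRing.Theory Num.Theory.
Local Open Scope ring_scope.

(* View a matrix x in gl_n as an F[t]-module. Harish-Chandra induction is then the
   Hall product (sum over stable subspaces W of a(x/W) b(x|W)), Harish-Chandra
   restriction is a coproduct, the two are adjoint for the Hermitian form, and the
   Mackey formula says that the coproduct is a morphism of algebras. The
   pre-cuspidal functions are the primitive elements; in each degree they form the
   orthogonal complement of the decomposable functions. This gives uniqueness by
   induction on n.
   For existence, D_n is built by induction on n as a morphism of bialgebras: on
   primitive elements it is the prescribed scalar, and a product al is sent to the
   product of (D (x) D) al. The latter is well defined: if al multiplies to 0,
   the Mackey formula and the lower degrees show that the product of (D (x) D) al
   has zero coproduct; being primitive and decomposable, it is orthogonal to
   itself. Neither commutativity nor associativity of the product is needed. *)

(** The relations between products are not known explicitly, so $\mathbb{D}_n$ cannot be defined by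
    generators and relations; positivity of the Hermitian form is what shows that every relation is
    respected, by turning self-orthogonality into vanishing. Products with a factor of degree 0
    contain the operator of degree N itself, so the induction works with tensors whose two factors
    have positive degree, and the degree 0 terms are restored at the end of each step. The
    submodules of a matrix have size [\rank W], which equals a prescribed degree only up to a proof.
    This is why functions are taken in all degrees at once and invariance is stated for similarity
    between matrices of a priori different sizes. The sign $(-1)^{n-1}$ enters as one choice of a
    sequence [c] of scalars, which is arbitrary during the construction. *)

Section Similarity.
Variable F : finFieldType.

(** The intertwiner is rectangular because the sizes of u and v are often equal only by a proof. *)
Definition hsim m n (u : 'M[F]_m) (v : 'M[F]_n) : bool :=
  [exists P : 'M[F]_(m, n), exists Q : 'M[F]_(n, m),
     [&& P *m Q == 1%:M, Q *m P == 1%:M & u *m P == P *m v]].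

Lemma hsimP m n (u : 'M[F]_m) (v : 'M[F]_n) :
  reflect (exists P : 'M[F]_(m, n), exists Q : 'M[F]_(n, m),
     [/\ P *m Q = 1%:M, Q *m P = 1%:M & u *m P = P *m v]) (hsim u v).
Proof.
apply: (iffP existsP) => [[P /existsP [Q /and3P [/eqP a /eqP b /eqP c]]]|[P [Q [a b c]]]].
  by exists P, Q.
by exists P; apply/existsP; exists Q; rewrite a b c !eqxx.
Qed.

Lemma hsim_refl n (u : 'M[F]_n) : hsim u u.
Proof. by apply/hsimP; exists 1%:M, 1%:M; rewrite !mulmx1 mul1mx. Qed.

Lemma hsim_sym m n (u : 'M[F]_m) (v : 'M[F]_n) : hsim u v = hsim v u.
Proof.
suff H m' n' (a : 'M[F]_m') (b : 'M[F]_n') : hsim a b -> hsim b a.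
  by apply/idP/idP; apply: H.
case/hsimP=> P [Q [PQ QP uP]]; apply/hsimP; exists Q, P; split=> //.
by rewrite -[b *m Q]mul1mx -QP -!mulmxA (mulmxA P) -uP -mulmxA PQ mulmx1.
Qed.

Lemma hsim_trans m n p (u : 'M[F]_m) (v : 'M[F]_n) (w : 'M[F]_p) :
  hsim u v -> hsim v w -> hsim u w.
Proof.
case/hsimP=> P [Q [PQ QP uP]] /hsimP [P' [Q' [PQ' QP' vP]]].
apply/hsimP; exists (P *m P'), (Q' *m Q); split.
- by rewrite mulmxA -(mulmxA P) PQ' mulmx1.
- by rewrite mulmxA -(mulmxA Q') QP mulmx1.
- by rewrite mulmxA uP -mulmxA vP mulmxA.
Qed.

Lemma hsim_dim m n (u : 'M[F]_m) (v : 'M[F]_n) : hsim u v -> m = n.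
Proof.
case/hsimP=> P [Q [PQ QP _]]; apply/eqP; rewrite eqn_leq.
have h a b (X : 'M[F]_(a, b)) (Y : 'M[F]_(b, a)) : X *m Y = 1%:M -> (a <= b)%N.
  by move=> XY; rewrite -[a](mxrank1 F) -XY mulmx_max_rank.
by rewrite (h _ _ _ _ PQ) (h _ _ _ _ QP).
Qed.

Lemma hsim_conj n (g x : 'M[F]_n) :
  g \in unitmx -> hsim (g *m x *m invmx g) x.
Proof.
move=> gu; apply/hsimP; exists g, (invmx g).
by rewrite mulmxV // mulVmx // -!mulmxA mulVmx // mulmx1.
Qed.

Lemma hsim_exists_eq m n (u : 'M[F]_m) : m = n -> exists v : 'M[F]_n, hsim u v.
Proof. by move=> <-; exists u; apply: hsim_refl. Qed.

End Similarity.

(** * Restriction of a matrix to a subspace and to the quotient *)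

Section SubQuotient.
Variables (F : finFieldType) (n : nat).
Implicit Types W x : 'M[F]_n.

(* Sealed, so that unification never unfolds the Gaussian elimination. *)
Fact adapted_bases W :
  {b : 'M[F]_(\rank W, n) * 'M[F]_(n, \rank W) *
       'M[F]_(n, \rank (cokermx W)) * 'M[F]_(\rank (cokermx W), n) |
   let: (R, R', C, T) := b in
   [/\ (R == W)%MS, R *m R' = 1%:M /\ T *m C = 1%:M, R *m C = 0
     & R' *m R + C *m T = 1%:M]}.
Proof.
have [R Rf RW] : {R : 'M[F]_(\rank W, n) | row_free R & (R == W)%MS}.
  by exists (row_base W); [apply: row_base_free | apply/eqmxP/eq_row_base].
have [C Cf WC] : {C : 'M[F]_(n, \rank (cokermx W)) | row_full C &
    forall m (A : 'M[F]_(m, n)), (A <= W)%MS = (A *m C == 0)}.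
  exists (col_base (cokermx W)); first exact: col_base_full.
  move=> m A; rewrite submxE -{1}(mulmx_base (cokermx W)) mulmxA.
  apply/eqP/eqP => [h|->]; last by rewrite mul0mx.
  by apply: (row_free_inj (row_base_free (cokermx W))); rewrite h mul0mx.
have [R' RR'] : {R' | R *m R' = 1%:M} by exists (pinvmx R); apply: mulmxVp.
have [T0 T0C] : {T0 | T0 *m C = 1%:M} by exists (pinvmx C); apply: mulVpmx.
have RC : R *m C = 0 by apply/eqP; rewrite -WC (eqmxP RW).
(* Removing from [T0] its component along [R] makes it vanish on [R']; it remains a section of [C]
   because [R *m C] is 0. *)
pose T := T0 - T0 *m R' *m R.
have TC : T *m C = 1%:M by rewrite mulmxBl -!mulmxA RC !mulmx0 subr0.
have TR' : T *m R' = 0 by rewrite mulmxBl -!mulmxA RR' mulmx1 subrr.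
exists (R, R', C, T); split=> //.
apply/eqP; rewrite eq_sym -subr_eq0 opprD addrA; set M := (_ - _).
have MC : M *m C = 0.
  by rewrite !mulmxBl -!mulmxA RC TC !mulmx0 mulmx1 mul1mx subr0 subrr.
have MR' : M *m R' = 0.
  by rewrite !mulmxBl -!mulmxA RR' TR' !mulmx0 mulmx1 mul1mx subr0 subrr.
have /submxP [D MD] : (M <= R)%MS by rewrite (eqmxP RW) WC MC.
by rewrite MD -[D]mulmx1 -RR' mulmxA -MD MR' mul0mx.
Qed.

(** With vectors as rows, [sub_in] is the inclusion of W and [quo_in] the projection onto the
    quotient by W; [sub_out] and [quo_out] are the retraction and the section that split them. *)
Definition sub_in W := (sval (adapted_bases W)).1.1.1.
Definition sub_out W := (sval (adapted_bases W)).1.1.2.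
Definition quo_in W := (sval (adapted_bases W)).1.2.
Definition quo_out W := (sval (adapted_bases W)).2.

Lemma sub_in_eq W : (sub_in W :=: W)%MS.
Proof. by rewrite /sub_in; case: adapted_bases => [[[[? ?] ?] ?] [h *]]; apply/eqmxP. Qed.

Lemma sub_in_out W : sub_in W *m sub_out W = 1%:M.
Proof. by rewrite /sub_in /sub_out; case: adapted_bases => [[[[? ?] ?] ?] [? []]]. Qed.

Lemma quo_out_in W : quo_out W *m quo_in W = 1%:M.
Proof. by rewrite /quo_in /quo_out; case: adapted_bases => [[[[? ?] ?] ?] [? []]]. Qed.

Lemma sub_in_quo_in W : sub_in W *m quo_in W = 0.
Proof. by rewrite /sub_in /quo_in; case: adapted_bases => [[[[? ?] ?] ?] []]. Qed.

Lemma sub_quo_id W : sub_out W *m sub_in W + quo_in W *m quo_out W = 1%:M.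
Proof.
by rewrite /sub_in /sub_out /quo_in /quo_out; case: adapted_bases => [[[[? ?] ?] ?] []].
Qed.

Lemma sub_ker_quo_in m (A : 'M[F]_(m, n)) W :
  (A <= W)%MS = (A *m quo_in W == 0).
Proof.
rewrite -sub_in_eq; apply/idP/eqP => [/submxP [D ->]|h].
  by rewrite -mulmxA sub_in_quo_in mulmx0.
by rewrite -[A]mulmx1 -(sub_quo_id W) mulmxDr !mulmxA h mul0mx addr0 submxMl.
Qed.

Definition resmx W x : 'M[F]_(\rank W) := sub_in W *m x *m sub_out W.
Definition quomx W x : 'M[F]_(\rank (cokermx W)) := quo_out W *m x *m quo_in W.

Lemma stablemxE W x : stablemx W x = (sub_in W *m x *m quo_in W == 0).
Proof. by rewrite -sub_ker_quo_in (eqmxMr x (sub_in_eq W)). Qed.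

(** Two bases of W differ by an invertible matrix, so the choice hidden in [sub_in] is harmless up
    to similarity. *)
Lemma resmx_sim W x r (R : 'M[F]_(r, n)) u :
  row_free R -> (R == W)%MS -> R *m x = u *m R -> hsim u (resmx W x).
Proof.
move=> Rf /eqmxP RW Rx.
have RI : R *m sub_out W *m sub_in W = R.
  have : (R <= sub_in W)%MS by rewrite sub_in_eq RW.
  by case/submxP=> D ->; rewrite -(mulmxA D) sub_in_out mulmx1.
apply/hsimP; exists (R *m sub_out W), (sub_in W *m pinvmx R); split.
- by rewrite mulmxA RI mulmxVp.
- have : (sub_in W <= R)%MS by rewrite sub_in_eq RW.
  case/submxP=> D DR; rewrite DR -(mulmxA D) mulmxVp // mulmx1 mulmxA -DR.
  exact: sub_in_out.
- by rewrite /resmx !mulmxA RI Rx.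
Qed.

Lemma quomx_sim W x s (S : 'M[F]_(n, s)) v :
  row_full S -> (kermx S == W)%MS -> x *m S = S *m v -> hsim v (quomx W x).
Proof.
move=> Sf /eqmxP SW xS.
have WS m (A : 'M[F]_(m, n)) : (A <= W)%MS = (A *m S == 0) by rewrite -SW; apply/sub_kermxP/eqP.
have SI : quo_in W *m quo_out W *m S = S.
  have /eqP : sub_in W *m S == 0 by rewrite -WS sub_in_eq.
  move=> h; rewrite -[RHS]mul1mx -(sub_quo_id W) mulmxDl -(mulmxA (sub_out W)) h.
  by rewrite mulmx0 add0r.
have IS : S *m pinvmx S *m quo_in W = quo_in W.
  apply/eqP; rewrite eq_sym -subr_eq0 -{1}(mul1mx (quo_in W)) -mulmxBl -sub_ker_quo_in WS.
  by rewrite mulmxBl mul1mx -mulmxA mulVpmx // mulmx1 subrr.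
have st : sub_in W *m x *m quo_in W = 0.
  apply/eqP; rewrite -sub_ker_quo_in WS -mulmxA xS mulmxA.
  by have /eqP -> : sub_in W *m S == 0 by [rewrite -WS sub_in_eq]; rewrite mul0mx.
apply/hsimP; exists (pinvmx S *m quo_in W), (quo_out W *m S); split.
- by rewrite mulmxA -(mulmxA (pinvmx S)) -(mulmxA (pinvmx S)) SI mulVpmx.
- by rewrite mulmxA -(mulmxA (quo_out W)) -(mulmxA (quo_out W)) IS quo_out_in.
- rewrite /quomx !mulmxA -(mulmxA (pinvmx S) (quo_in W)).
  have -> : quo_in W *m quo_out W = 1%:M - sub_out W *m sub_in W.
    by rewrite -(sub_quo_id W) addrAC subrr add0r.
  rewrite mulmxBr mulmx1 !mulmxBl -!mulmxA (mulmxA (sub_in W)) st !mulmx0 subr0.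
  by rewrite -{2}IS !mulmxA -(mulmxA (pinvmx S) x) xS !mulmxA mulVpmx // mul1mx.
Qed.

End SubQuotient.

(** * Split exact sequences of row spaces *)

Section Adapted.
Variable F : finFieldType.

(** A split short exact sequence: [R] includes the subspace, [Q] projects onto the quotient, [R']
    and [T] split them. The free sizes r and s let splittings be summed in blocks and sheared. *)
Definition adapted n r s (R : 'M[F]_(r, n)) (R' : 'M[F]_(n, r))
    (Q : 'M[F]_(n, s)) (T : 'M[F]_(s, n)) :=
  [/\ R *m R' = 1%:M, T *m Q = 1%:M, R *m Q = 0 & R' *m R + Q *m T = 1%:M].

Lemma adapted_sub_quo n (W : 'M[F]_n) :
  adapted (sub_in W) (sub_out W) (quo_in W) (quo_out W).
Proof. by split; rewrite ?sub_in_out ?quo_out_in ?sub_in_quo_in ?sub_quo_id. Qed.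

Section AdaptedTheory.
Variables (n r s : nat) (R : 'M[F]_(r, n)) (R' : 'M[F]_(n, r)).
Variables (Q : 'M[F]_(n, s)) (T : 'M[F]_(s, n)).
Hypothesis RQ : adapted R R' Q T.

Lemma adapted_free : row_free R.
Proof. by apply/row_freeP; exists R'; case: RQ. Qed.

Lemma adapted_full : row_full Q.
Proof. by apply/row_fullP; exists T; case: RQ. Qed.

Lemma adapted_sub m (A : 'M[F]_(m, n)) : (A <= R)%MS = (A *m Q == 0).
Proof.
case: RQ => _ _ h1 h2; apply/idP/eqP => [/submxP [D ->]|h].
  by rewrite -mulmxA h1 mulmx0.
by rewrite -[A]mulmx1 -h2 mulmxDr !mulmxA h mul0mx addr0 submxMl.
Qed.

Lemma adapted_ker : (kermx Q == R)%MS.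
Proof.
rewrite adapted_sub mulmx_ker eqxx /=; apply/sub_kermxP.
by case: RQ.
Qed.

(** Inserting the resolution of the identity between [T] and [R'] produces their product twice. *)
Lemma adapted_TR' : T *m R' = 0.
Proof.
case: RQ => h1 h2 _ h4; apply: (addrI (T *m R')); rewrite addr0.
rewrite -{3}[T]mulmx1 -h4 mulmxDr mulmxDl !mulmxA h2 mul1mx -!mulmxA h1 mulmx1.
by [].
Qed.

Lemma adapted_stable x : stablemx <<R>>%MS x = (R *m x *m Q == 0).
Proof. by rewrite genmxE (eqmxMr x (genmxE R)) adapted_sub. Qed.

Lemma adapted_res x : R *m x *m Q = 0 -> hsim (R *m x *m R') (resmx <<R>>%MS x).
Proof.
move=> st; apply: (@resmx_sim _ _ _ _ _ R).
- exact: adapted_free.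
- exact/eqmxP/eqmx_sym/genmxE.
- case: RQ => _ _ _ h; rewrite -{1}[R *m x]mulmx1 -h mulmxDr !mulmxA st.
  by rewrite mul0mx addr0.
Qed.

Lemma adapted_quo x : R *m x *m Q = 0 -> hsim (T *m x *m Q) (quomx <<R>>%MS x).
Proof.
move=> st; apply: (@quomx_sim _ _ _ _ _ Q).
- exact: adapted_full.
- by apply/eqmxP; apply: eqmx_trans (eqmxP adapted_ker) (eqmx_sym (genmxE R)).
- case: RQ => _ _ _ h; rewrite -{1}[x *m Q]mul1mx -h mulmxDl -!mulmxA.
  by rewrite (mulmxA R) st mulmx0 add0r.
Qed.

End AdaptedTheory.

Lemma adapted_block n1 n2 r1 r2 s1 s2
   (R1 : 'M[F]_(r1, n1)) R1' (Q1 : 'M[F]_(n1, s1)) T1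
   (R2 : 'M[F]_(r2, n2)) R2' (Q2 : 'M[F]_(n2, s2)) T2 :
  adapted R1 R1' Q1 T1 -> adapted R2 R2' Q2 T2 ->
  adapted (block_mx R1 0 0 R2) (block_mx R1' 0 0 R2')
          (block_mx Q1 0 0 Q2) (block_mx T1 0 0 T2).
Proof.
move=> [a b c d] [a' b' c' d']; split; rewrite !mulmx_block !mulmx0 !mul0mx ?addr0 ?add0r.
- by rewrite a a' -scalar_mx_block.
- by rewrite b b' -scalar_mx_block.
- by rewrite c c' block_mx0.
- by rewrite add_block_mx !addr0 d d' -scalar_mx_block.
Qed.

Lemma adapted_unit n r s (R : 'M[F]_(r, n)) R' (Q : 'M[F]_(n, s)) T (h k : 'M[F]_n) :
  h *m k = 1%:M -> adapted R R' Q T ->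
  adapted (R *m h) (k *m R') (k *m Q) (T *m h).
Proof.
move=> hk [a b c d]; have kh := mulmx1C hk.
have E m p (A : 'M[F]_(m, n)) (B : 'M[F]_(n, p)) : A *m h *m (k *m B) = A *m B.
  by rewrite mulmxA -(mulmxA A) hk mulmx1.
split; rewrite ?E //.
by rewrite !mulmxA -mulmxDl -!(mulmxA k) -mulmxDr d mulmx1 kh.
Qed.

End Adapted.

(** * Product and coproduct on functions of all degrees *)

Section Hall.
Variables (F : finFieldType) (K : numClosedFieldType).

(* Functions of all degrees at once: elements of the completed Hall algebra of
   finite-dimensional F[t]-modules, and of its tensor square. *)
Definition fun1 := forall n, 'M[F]_n -> K.
Definition fun2 := forall m n, 'M[F]_m -> 'M[F]_n -> K.

Definition inv1 (a : fun1) :=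
  forall m n (u : 'M[F]_m) (v : 'M[F]_n), hsim u v -> a m u = a n v.
Definition inv2 (al : fun2) :=
  forall m m' n n' (u : 'M[F]_m) (u' : 'M[F]_m') (v : 'M[F]_n) (v' : 'M[F]_n'),
    hsim u u' -> hsim v v' -> al m n u v = al m' n' u' v'.

(* Vectors are rows, on which x acts from the right. In every two-variable
   function the quotient comes first and the submodule second. *)
Definition hmul (al : fun2) : fun1 := fun n x =>
  \sum_(W : 'M[F]_n | (<<W>>%MS == W) && stablemx W x)
     al _ _ (quomx W x) (resmx W x).

(** Restriction along the two-block parabolic, whose unipotent radical is the space of upper right
    corners y. *)
Definition hdel (a : fun1) : fun2 := fun n1 n2 x1 x2 =>
  #|{: 'M[F]_(n1, n2)}|%:R^-1 *
  \sum_(y : 'M[F]_(n1, n2)) a (n1 + n2)%N (block_mx x1 y 0 x2).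

(** In the basis [T] followed by [R] the matrix is block upper triangular. The subspace comes last
    because vectors are rows. *)
Lemma inv1E (a : fun1) n r s (R : 'M[F]_(r, n)) R' (Q : 'M[F]_(n, s)) T (x : 'M[F]_n) :
  inv1 a -> adapted R R' Q T -> R *m x *m Q = 0 ->
  a n x = a _ (block_mx (T *m x *m Q) (T *m x *m R') 0 (R *m x *m R')).
Proof.
move=> ai ad st; apply: ai; have TR := adapted_TR' ad.
case: ad => h1 h2 h3 h4; apply/hsimP.
exists (row_mx Q R'), (col_mx T R); split.
- by rewrite mul_row_col addrC.
- by rewrite mul_col_row h1 h2 h3 TR -scalar_mx_block.
- rewrite mul_mx_row mul_row_block mulmx0 addr0 -!mulmxA !(mulmxA Q) !(mulmxA R').
  have -> : Q *m T = 1%:M - R' *m R by rewrite -h4 addrAC subrr add0r.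
  rewrite !mulmxBl !mul1mx -!mulmxA.
  have -> : R *m (x *m Q) = 0 by rewrite mulmxA.
  by rewrite mulmx0 subr0 subrK.
Qed.

End Hall.

(** * Linear maps carrying one subspace into another *)

Section Sums.
Variables (F : finFieldType) (K : numClosedFieldType).

Lemma card_mx_neq0 m n : (#|{: 'M[F]_(m, n)}|%:R : K) != 0.
Proof. by rewrite pnatr_eq0 -lt0n; apply/card_gt0P; exists 0. Qed.

Lemma adapted_coords n1 n2 r1 r2 s1 s2
   (R1 : 'M[F]_(r1, n1)) R1' (Q1 : 'M[F]_(n1, s1)) T1
   (R2 : 'M[F]_(r2, n2)) R2' (Q2 : 'M[F]_(n2, s2)) T2 p q t
   (y := R1' *m q *m R2 + Q1 *m p *m T2 + Q1 *m t *m R2) :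
  adapted R1 R1' Q1 T1 -> adapted R2 R2' Q2 T2 ->
  [/\ T1 *m y *m Q2 = p, R1 *m y *m R2' = q, T1 *m y *m R2' = t
    & R1 *m y *m Q2 = 0].
Proof.
move=> ad1 ad2; have u1 := adapted_TR' ad1; have u2 := adapted_TR' ad2.
case: ad1 => a1 a2 a3 _; case: ad2 => b1 b2 b3 _; rewrite /y.
by split; rewrite !mulmxDr !mulmxDl !mulmxA ?u1 ?a1 ?a2 ?a3 -?mulmxA ?u2 ?b1 ?b2 ?b3
  ?mul0mx ?mulmx0 ?mul1mx ?mulmx1 ?addr0 ?add0r.
Qed.

Lemma adapted_decomp n1 n2 r1 r2 s1 s2
   (R1 : 'M[F]_(r1, n1)) R1' (Q1 : 'M[F]_(n1, s1)) T1
   (R2 : 'M[F]_(r2, n2)) R2' (Q2 : 'M[F]_(n2, s2)) T2 (y : 'M[F]_(n1, n2)) :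
  adapted R1 R1' Q1 T1 -> adapted R2 R2' Q2 T2 -> R1 *m y *m Q2 = 0 ->
  R1' *m (R1 *m y *m R2') *m R2 + Q1 *m (T1 *m y *m Q2) *m T2
    + Q1 *m (T1 *m y *m R2') *m R2 = y.
Proof.
move=> [_ _ _ a] [_ _ _ b] st.
rewrite -[RHS]mul1mx -[RHS]mulmx1 -a -b !mulmxDr !mulmxDl !mulmxA.
have -> : R1' *m R1 *m y *m Q2 *m T2 = 0.
  by rewrite -!mulmxA (mulmxA R1) (mulmxA _ Q2) st mul0mx mulmx0.
by rewrite add0r addrAC.
Qed.

(** In adapted coordinates a map sending the first subspace into the second has three free blocks:
    quotient to quotient, subspace to subspace, and quotient to subspace. *)
Lemma sum_adapted n1 n2 r1 r2 s1 s2
   (R1 : 'M[F]_(r1, n1)) R1' (Q1 : 'M[F]_(n1, s1)) T1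
   (R2 : 'M[F]_(r2, n2)) R2' (Q2 : 'M[F]_(n2, s2)) T2
   (g : 'M[F]_(s1, s2) -> 'M[F]_(r1, r2) -> 'M[F]_(s1, r2) -> K) :
  adapted R1 R1' Q1 T1 -> adapted R2 R2' Q2 T2 ->
  \sum_(y : 'M[F]_(n1, n2) | R1 *m y *m Q2 == 0)
     g (T1 *m y *m Q2) (R1 *m y *m R2') (T1 *m y *m R2')
  = \sum_p \sum_q \sum_t g p q t.
Proof.
move=> ad1 ad2; under [RHS]eq_bigr do rewrite pair_bigA; rewrite pair_bigA /=.
pose h (j : 'M[F]_(s1, s2) * ('M[F]_(r1, r2) * 'M[F]_(s1, r2))) : 'M[F]_(n1, n2) :=
  R1' *m j.2.1 *m R2 + Q1 *m j.1 *m T2 + Q1 *m j.2.2 *m R2.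
rewrite (reindex_onto h
   (fun y : 'M[F]_(n1, n2) => (T1 *m y *m Q2, (R1 *m y *m R2', T1 *m y *m R2')))) /=; last first.
  by move=> y /eqP st; apply: adapted_decomp.
have hE j := adapted_coords j.1 j.2.1 j.2.2 ad1 ad2.
apply: eq_big => [[p [q t]]|[p [q t]] _]; rewrite /h;
  by case: (hE (p, (q, t))) => /= -> -> -> e; rewrite ?e ?eqxx.
Qed.

End Sums.

(** * Adjunction between product and coproduct *)

Section Pairing.
Variables (F : finFieldType) (K : numClosedFieldType).

(** For fixed W, a matrix stabilizing W amounts to a quotient block, a restriction block and a free
    corner. Summing the invariant [z] over the corner gives [hdel z] times the number of corners.
    The form is bilinear here; conjugation is put into [b] by the callers. *)
Lemma hmul_pairing (z : fun1 F K) (b : fun2 F K) N : inv1 z ->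
  \sum_(x : 'M[F]_N) z N x * hmul b x
  = \sum_(W : 'M[F]_N | <<W>>%MS == W)
      #|{: 'M[F]_(\rank (cokermx W), \rank W)}|%:R *
      \sum_(v : 'M[F]_(\rank (cokermx W))) \sum_(u : 'M[F]_(\rank W))
        hdel z v u * b _ _ v u.
Proof.
move=> zi; rewrite /hmul.
under eq_bigr => x _ do rewrite big_distrr big_mkcondr /=.
rewrite exchange_big /=; apply: eq_bigr => W /eqP cW; rewrite -big_mkcond /=.
have ad := adapted_sub_quo W.
rewrite (eq_bigl (fun x => sub_in W *m x *m quo_in W == 0)); last first.
  by move=> x; rewrite stablemxE.
pose g (v : 'M[F]_(\rank (cokermx W))) (u : 'M[F]_(\rank W)) w :=
  z _ (block_mx v w 0 u) * b _ _ v u.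
rewrite (eq_bigr (fun x => g (quo_out W *m x *m quo_in W)
   (sub_in W *m x *m sub_out W) (quo_out W *m x *m sub_out W))); last first.
  by move=> x /eqP st; rewrite (inv1E zi ad st).
rewrite (sum_adapted g ad ad) big_distrr; apply: eq_bigr => v _ /=.
rewrite big_distrr; apply: eq_bigr => u _ /=.
by rewrite /g /hdel -big_distrl mulrA mulrA mulfV ?mul1r // card_mx_neq0.
Qed.

End Pairing.

(** * Subspaces of a direct sum *)

Section Glue.
Variables (F : finFieldType) (n1 n2 : nat).
Implicit Types (W : 'M[F]_(n1 + n2)).
Implicit Types (Th : 'M[F]_(n1, n2)).

Let H Th : 'M[F]_(n1 + n2) := block_mx 1%:M Th 0 1%:M.

Lemma shearN Th : H Th *m H (- Th) = 1%:M.
Proof.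
by rewrite mulmx_block !mulmx0 !mul0mx !mulmx1 !mul1mx addr0 !add0r addrC subrr -scalar_mx_block.
Qed.

(* The subspaces W with image W1 in the first block and intersection W2 with the
   second one are the shears [glue W1 W2 Th] of W1 + W2. *)
Definition glue (W1 : 'M[F]_n1) (W2 : 'M[F]_n2) Th : 'M[F]_(n1 + n2) :=
  <<block_mx (sub_in W1) 0 0 (sub_in W2) *m H Th>>%MS.

Lemma adapted_glue (W1 : 'M[F]_n1) (W2 : 'M[F]_n2) Th :
  adapted (block_mx (sub_in W1) 0 0 (sub_in W2) *m H Th)
          (H (- Th) *m block_mx (sub_out W1) 0 0 (sub_out W2))
          (H (- Th) *m block_mx (quo_in W1) 0 0 (quo_in W2))
          (block_mx (quo_out W1) 0 0 (quo_out W2) *m H Th).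
Proof.
apply: adapted_unit; first exact: shearN.
by apply: adapted_block; apply: adapted_sub_quo.
Qed.

Lemma glue_inE (W1 : 'M[F]_n1) (W2 : 'M[F]_n2) Th :
  block_mx (sub_in W1) 0 0 (sub_in W2) *m H Th
  = block_mx (sub_in W1) (sub_in W1 *m Th) 0 (sub_in W2).
Proof. by rewrite mulmx_block !mulmx0 !mul0mx !mulmx1 !addr0 !add0r. Qed.

Lemma glue_quoE (W1 : 'M[F]_n1) (W2 : 'M[F]_n2) Th :
  H (- Th) *m block_mx (quo_in W1) 0 0 (quo_in W2)
  = block_mx (quo_in W1) (- (Th *m quo_in W2)) 0 (quo_in W2).
Proof. by rewrite mulmx_block !mulmx0 !mul0mx !mul1mx !addr0 !add0r mulNmx. Qed.

(** A shear moves W1 + W2 only through the map from W1 to the quotient by W2 that it induces. *)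
Lemma glue_eq (W1 : 'M[F]_n1) (W2 : 'M[F]_n2) Th Th' :
  (glue W1 W2 Th == glue W1 W2 Th') =
  (sub_in W1 *m (Th - Th') *m quo_in W2 == 0).
Proof.
have E Th1 Th2 : (glue W1 W2 Th1 <= glue W1 W2 Th2)%MS =
  (sub_in W1 *m (Th1 - Th2) *m quo_in W2 == 0).
  rewrite !genmxE (adapted_sub (adapted_glue W1 W2 Th2)) glue_inE glue_quoE.
  rewrite mulmx_block !mulmx0 !mul0mx !sub_in_quo_in !addr0.
  rewrite mulmxN mulmxBr mulmxBl !mulmxA addrC.
  by apply/eqP/eqP => [/eqP|->]; [rewrite -block_mx0 => /eqP /eq_block_mx [] | rewrite block_mx0].
apply/eqP/idP => [e|e]; first by rewrite -E e.
suff : (glue W1 W2 Th == glue W1 W2 Th')%MS.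
  by move/genmxP; rewrite /glue !genmx_id.
apply/andP; rewrite !E e; split=> //.
by rewrite -opprB mulmxN mulNmx oppr_eq0.
Qed.

Definition proj_sub W : 'M[F]_n1 := <<lsubmx W>>%MS.
Definition inter_sub W : 'M[F]_n2 :=
  <<rsubmx (W :&: (row_mx 0 1%:M : 'M[F]_(n2, n1 + n2)))%MS>>%MS.

Lemma inter_subP W m (A : 'M[F]_(m, n2)) :
  (A <= inter_sub W)%MS = (row_mx (0 : 'M[F]_(m, n1)) A <= W)%MS.
Proof.
rewrite genmxE; set E : 'M[F]_(n2, n1 + n2) := row_mx 0 1%:M.
have AE k (B : 'M[F]_(k, n2)) : row_mx 0 B = B *m E by rewrite mul_mx_row mulmx0 mulmx1.
set C := (W :&: E)%MS.
have CE : C = row_mx 0 (rsubmx C).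
  have /submxP [D DC] : (C <= E)%MS by apply: capmxSr.
  by rewrite {2}DC mul_mx_row mulmx0 mulmx1 row_mxKr DC mul_mx_row mulmx0 mulmx1.
apply/idP/idP => [/submxP [D ->]|h].
  have -> : row_mx 0 (D *m rsubmx C) = D *m C by rewrite {2}CE mul_mx_row mulmx0.
  by apply: submx_trans (submxMl _ _) (capmxSl _ _).
have /submxP [D] : (row_mx 0 A <= C)%MS by rewrite sub_capmx h AE submxMl.
by rewrite {1}CE mul_mx_row mulmx0 => /eq_row_mx [_ ->]; apply: submxMl.
Qed.

Lemma proj_glue (W1 : 'M[F]_n1) (W2 : 'M[F]_n2) Th : <<W1>>%MS = W1 -> proj_sub (glue W1 W2 Th) = W1.
Proof.
move=> c1; rewrite -[RHS]c1; apply/genmxP/eqmxP; rewrite /glue glue_inE.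
have L m (A : 'M[F]_(m, n1 + n2)) : lsubmx A = A *m col_mx 1%:M 0.
  by rewrite -{2}[A]hsubmxK mul_row_col mulmx1 mulmx0 addr0.
rewrite L; apply: eqmx_trans (eqmxMr _ (genmxE _)) _; rewrite -L block_mxEh row_mxKl.
apply: eqmx_trans (eqmx_sym (addsmxE _ _)) _.
exact: eqmx_trans (addsmx0 _ _) (sub_in_eq W1).
Qed.

Lemma inter_glue (W1 : 'M[F]_n1) (W2 : 'M[F]_n2) Th : <<W2>>%MS = W2 -> inter_sub (glue W1 W2 Th) = W2.
Proof.
move=> c2; have E m (A : 'M[F]_(m, n2)) : (A <= inter_sub (glue W1 W2 Th))%MS = (A <= W2)%MS.
  rewrite inter_subP genmxE (adapted_sub (adapted_glue W1 W2 Th)) glue_quoE.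
  rewrite mul_row_block !mul0mx !mulmx0 !add0r sub_ker_quo_in.
  by apply/eqP/eqP => [/eqP|->]; [rewrite -row_mx0 => /eqP /eq_row_mx [] | rewrite row_mx0].
rewrite -[RHS]c2 -[LHS]genmx_id; apply/genmxP/andP.
by rewrite -E submx_refl E submx_refl.
Qed.

Lemma glue_surj W : <<W>>%MS = W ->
  exists Th, glue (proj_sub W) (inter_sub W) Th = W.
Proof.
move=> cW; set W1 := proj_sub W; set W2 := inter_sub W.
have [D DR] : exists D, sub_in W1 = D *m lsubmx W.
  by apply/submxP; rewrite sub_in_eq genmxE.
(* [D] lifts the basis of the projection to vectors of W; [Th] sends each basis vector to the second
   component of its lift. *)
exists (sub_out W1 *m (D *m rsubmx W)).
have RV : sub_in W1 *m (sub_out W1 *m (D *m rsubmx W)) = D *m rsubmx W.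
  by rewrite mulmxA sub_in_out mul1mx.
have DW : row_mx (sub_in W1) (D *m rsubmx W) = D *m W.
  by rewrite DR -mul_mx_row hsubmxK.
rewrite -[RHS]cW; apply/genmxP/andP; split.
  rewrite glue_inE RV block_mxEv col_mx_sub DW submxMl /=.
  by rewrite -inter_subP sub_in_eq.
rewrite (adapted_sub (adapted_glue _ _ _)) glue_quoE.
have /submxP [c lc] : (lsubmx W <= sub_in W1)%MS by rewrite sub_in_eq genmxE.
(* A row of W minus the lift of its projection lies in the second block, hence in the
   intersection. *)
have : (rsubmx W - c *m (D *m rsubmx W) <= W2)%MS.
  rewrite inter_subP.
  have -> : row_mx 0 (rsubmx W - c *m (D *m rsubmx W)) = W - c *m (D *m W).
    by rewrite -DW mul_mx_row -lc -{3}[W]hsubmxK opp_row_mx add_row_mx subrr.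
  by rewrite mulmxA -[X in (X - _ <= _)%MS]mul1mx -mulmxBl submxMl.
rewrite sub_ker_quo_in mulmxBl => /eqP h.
have e1 : lsubmx W *m quo_in W1 = 0 by rewrite {1}lc -mulmxA sub_in_quo_in mulmx0.
have e2 : lsubmx W *m (sub_out W1 *m (D *m rsubmx W)) = c *m (D *m rsubmx W).
  by rewrite {1}lc -mulmxA RV.
rewrite -{1}[W]hsubmxK mul_row_block mulmx0 addr0 e1 mulmxN (mulmxA (lsubmx W)) e2 addrC h.
by rewrite row_mx0.
Qed.

End Glue.

(** * Similarity invariance of product and coproduct *)

Section Invariance.
Variables (F : finFieldType) (K : numClosedFieldType).

Lemma hsim_conjP n (u v : 'M[F]_n) :
  reflect (exists P Q, [/\ P *m Q = 1%:M, Q *m P = 1%:M & u = P *m v *m Q])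
          (hsim u v).
Proof.
apply: (iffP (hsimP _ _)) => [[P [Q [a b c]]]|[P [Q [a b ->]]]]; exists P, Q; split=> //.
  by rewrite -c -mulmxA a mulmx1.
by rewrite -mulmxA b mulmx1.
Qed.

Lemma hmul_inv (al : fun2 F K) : inv2 al -> inv1 (hmul al).
Proof.
move=> ai m n u v uv; have e := hsim_dim uv; subst m.
case/hsim_conjP: uv => P [Q [PQ QP ->]].
have canK (A B : 'M[F]_n) : A *m B = 1%:M -> forall W : 'M[F]_n,
    <<W>>%MS == W -> <<<<W *m A>> *m B>>%MS = W.
  move=> AB W /eqP {2}<-; apply/genmxP/eqmxP.
  by apply: eqmx_trans (eqmxMr _ (genmxE _)) _; rewrite -mulmxA AB mulmx1.
(* Right multiplication by [P] carries the subspaces stable under [P *m v *m Q] to those stable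
   under [v]. *)
rewrite /hmul [RHS](reindex_onto (fun W : 'M[F]_n => <<W *m P>>%MS)
  (fun W : 'M[F]_n => <<W *m Q>>%MS)) /=; last first.
  by move=> W /andP [cW _]; apply: canK.
have ad W : adapted (sub_in W *m P) (Q *m sub_out W) (Q *m quo_in W) (quo_out W *m P).
  by apply: adapted_unit (adapted_sub_quo W).
have gW (W : 'M[F]_n) : <<W *m P>>%MS = <<sub_in W *m P>>%MS.
  by apply/genmxP/eqmxP/eqmxMr/eqmx_sym/sub_in_eq.
have stE (W : 'M[F]_n) : stablemx <<W *m P>>%MS v = stablemx W (P *m v *m Q).
  by rewrite gW (adapted_stable (ad W)) stablemxE !mulmxA.
apply: eq_big => [W|W /andP [cW st]].
  rewrite genmx_id eqxx /= stE andbC.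
  case: (boolP (stablemx _ _)) => //= _; apply/idP/eqP => [|<-]; first exact: canK.
  by rewrite genmx_id.
have st' : sub_in W *m P *m v *m (Q *m quo_in W) = 0.
  by move: st; rewrite stablemxE => /eqP; rewrite !mulmxA.
have q1 := adapted_quo (ad W) st'; have r1 := adapted_res (ad W) st'.
by rewrite gW; apply: ai; rewrite /quomx /resmx !mulmxA in q1 r1 *.
Qed.

Lemma hdel_inv (a : fun1 F K) : inv1 a -> inv2 (hdel a).
Proof.
move=> ai m m' n n' u u' v v' uu vv.
have e1 := hsim_dim uu; have e2 := hsim_dim vv; subst m' n'.
case/hsim_conjP: uu => P [Q [PQ QP ->]]; case/hsim_conjP: vv => R [S' [RS SR ->]].
congr (_ * _); rewrite [LHS](reindex_onto (fun y : 'M[F]_(m, n) => P *m y *m S')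
  (fun y : 'M[F]_(m, n) => Q *m y *m R)) /=; last first.
  by move=> y _; rewrite !mulmxA PQ mul1mx -mulmxA RS mulmx1.
apply: eq_big => [y|y _]; first by rewrite !mulmxA QP mul1mx -mulmxA SR mulmx1 eqxx.
apply: ai; apply/hsim_conjP; exists (block_mx P 0 0 R), (block_mx Q 0 0 S').
rewrite !mulmx_block !mulmx0 !mul0mx !addr0 !add0r PQ QP RS SR !mul0mx ?addr0.
by rewrite -!scalar_mx_block.
Qed.

End Invariance.

(** * The Mackey formula *)

Section Mackey.
Variables (F : finFieldType) (K : numClosedFieldType).

(** The coproduct applied to both tensor factors. In the Mackey formula the pairs (q1, s1) and (q2,
    s2) are multiplied, which is the usual exchange of the two middle factors. *)
Definition hdel2 (al : fun2 F K) a b c d (q1 : 'M[F]_a) (q2 : 'M[F]_b)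
    (s1 : 'M[F]_c) (s2 : 'M[F]_d) : K :=
  hdel (fun m u => hdel (fun n v => al m n u v) s1 s2) q1 q2.

(** By [glue_eq] this is the number of shears that give the same glued subspace. *)
Definition cross n1 n2 (W1 : 'M[F]_n1) (W2 : 'M[F]_n2) :=
  #|[pred y : 'M[F]_(n1, n2) | sub_in W1 *m y *m quo_in W2 == 0]|.

Lemma card_cross n1 n2 (W1 : 'M[F]_n1) (W2 : 'M[F]_n2) :
  (cross W1 W2)%:R =
  #|{: 'M[F]_(\rank (cokermx W1), \rank (cokermx W2))}|%:R *
  (#|{: 'M[F]_(\rank W1, \rank W2)}|%:R *
   #|{: 'M[F]_(\rank (cokermx W1), \rank W2)}|%:R) :> K.
Proof.
transitivity (\sum_(y : 'M[F]_(n1, n2) | sub_in W1 *m y *m quo_in W2 == 0) (1 : K)).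
  by rewrite -sumr_const; apply: eq_bigl => y; rewrite inE.
rewrite (sum_adapted (fun _ _ _ => 1 : K) (adapted_sub_quo W1) (adapted_sub_quo W2)).
by rewrite !sumr_const !mulr_natl.
Qed.

(** Every subspace is glued from its projection and its intersection, so summing over all shears
    counts it [cross W1 W2] times. *)
Lemma sum_glue n1 n2 (f : 'M[F]_(n1 + n2) -> K) :
  \sum_(W : 'M[F]_(n1 + n2) | <<W>>%MS == W) f W =
  \sum_(W1 : 'M[F]_n1 | <<W1>>%MS == W1) \sum_(W2 : 'M[F]_n2 | <<W2>>%MS == W2)
    (cross W1 W2)%:R^-1 * \sum_(Th : 'M[F]_(n1, n2)) f (glue W1 W2 Th).
Proof.
rewrite (partition_big (@proj_sub F n1 n2) (fun W1 => <<W1>>%MS == W1)) /=; last first.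
  by move=> W _; rewrite genmx_id.
apply: eq_bigr => W1 /eqP c1.
rewrite (partition_big (@inter_sub F n1 n2) (fun W2 => <<W2>>%MS == W2)) /=; last first.
  by move=> W _; rewrite genmx_id.
apply: eq_bigr => W2 /eqP c2.
pose P (W : 'M[F]_(n1 + n2)) := (<<W>>%MS == W) && (proj_sub W == W1) && (inter_sub W == W2).
rewrite (partition_big (glue W1 W2) P) /=; last first.
  by move=> Th _; rewrite /P proj_glue // inter_glue // genmx_id !eqxx.
rewrite big_distrr /=; apply: eq_bigr => W /andP [/andP [/eqP cW /eqP p1] /eqP p2].
have [Th0 g0] := glue_surj cW; rewrite p1 p2 in g0.
rewrite (eq_bigr (fun=> f W)) => [|Th /eqP -> //]; rewrite sumr_const.
have -> : #|[pred Th | glue W1 W2 Th == W]| = cross W1 W2.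
  rewrite -(card_image (addIr (- Th0))); apply: eq_card => y; rewrite !inE.
  apply/imageP/idP => [[Th]|h].
    by rewrite inE -{1}g0 glue_eq => h ->.
  by exists (y + Th0); rewrite ?addrK // inE -g0 glue_eq addrK.
rewrite -[f W *+ _]mulr_natr mulrCA mulVf ?mulr1 // card_cross.
by rewrite !mulf_neq0 // card_mx_neq0.
Qed.

(** Conjugating by the shear that defines W brings W back to W1 + W2 and only translates the corner
    y. The sum over shears thus becomes a plain count, and all cardinals cancel: no power of q is
    left. *)
Lemma hdel_hmul (al : fun2 F K) n1 n2 (x1 : 'M[F]_n1) (x2 : 'M[F]_n2) :
  inv2 al ->
  hdel (hmul al) x1 x2 =
  \sum_(W1 : 'M[F]_n1 | (<<W1>>%MS == W1) && stablemx W1 x1)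
  \sum_(W2 : 'M[F]_n2 | (<<W2>>%MS == W2) && stablemx W2 x2)
    hdel2 al (quomx W1 x1) (quomx W2 x2) (resmx W1 x1) (resmx W2 x2).
Proof.
move=> ai; rewrite /hdel /hmul.
pose X (y : 'M[F]_(n1, n2)) := block_mx x1 y 0 x2.
pose Z (W1 : 'M[F]_n1) (W2 : 'M[F]_n2) y := sub_in W1 *m y *m quo_in W2 == 0.
pose val W1 W2 (y : 'M[F]_(n1, n2)) := al _ _
  (block_mx (quomx W1 x1) (quo_out W1 *m y *m quo_in W2) 0 (quomx W2 x2))
  (block_mx (resmx W1 x1) (sub_in W1 *m y *m sub_out W2) 0 (resmx W2 x2)).
pose f y (W : 'M[F]_(n1 + n2)) := if stablemx W (X y) then
  al _ _ (quomx W (X y)) (resmx W (X y)) else 0.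
have fE W1 W2 y Th : f y (glue W1 W2 Th) =
    if [&& stablemx W1 x1, stablemx W2 x2 & Z W1 W2 (y + (Th *m x2 - x1 *m Th))]
    then val W1 W2 (y + (Th *m x2 - x1 *m Th)) else 0.
  set y' := (y + _); have ad := adapted_glue W1 W2 Th.
  set H := block_mx 1%:M Th 0 1%:M in ad; set H' := block_mx 1%:M (- Th) 0 1%:M in ad.
  have HX : H *m X y *m H' = X y'.
    rewrite !mulmx_block !mulmx0 !mul0mx !mulmx1 !mul1mx !addr0 !add0r.
    by rewrite mul0mx add0r mulmxN addrC -addrA.
  have cjE m p (A : 'M[F]_(m, n1 + n2)) (B : 'M[F]_(n1 + n2, p)) :
    A *m H *m X y *m (H' *m B) = A *m X y' *m B by rewrite -HX !mulmxA.
  have stE : stablemx (glue W1 W2 Th) (X y) = [&& stablemx W1 x1, stablemx W2 x2 & Z W1 W2 y'].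
    rewrite (adapted_stable ad) cjE !stablemxE !mulmx_block !(mulmx0, mul0mx, addr0, add0r).
    apply/eqP/and3P => [/eqP|[/eqP -> /eqP -> /eqP ->]]; last by rewrite block_mx0.
    by rewrite -block_mx0 => /eqP /eq_block_mx [/eqP ? /eqP ? _ /eqP ?].
  rewrite /f stE; case: ifP => // /and3P [st1 st2 st3].
  have st := introT and3P (And3 st1 st2 st3); rewrite -stE (adapted_stable ad) in st.
  have qE : block_mx (quo_out W1) 0 0 (quo_out W2) *m H *m X y *m
      (H' *m block_mx (quo_in W1) 0 0 (quo_in W2)) =
      block_mx (quomx W1 x1) (quo_out W1 *m y' *m quo_in W2) 0 (quomx W2 x2).
    by rewrite cjE !mulmx_block !(mulmx0, mul0mx, addr0, add0r).
  have rE : block_mx (sub_in W1) 0 0 (sub_in W2) *m H *m X y *m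
      (H' *m block_mx (sub_out W1) 0 0 (sub_out W2)) =
      block_mx (resmx W1 x1) (sub_in W1 *m y' *m sub_out W2) 0 (resmx W2 x2).
    by rewrite cjE !mulmx_block !(mulmx0, mul0mx, addr0, add0r).
  rewrite /val -qE -rE; apply/esym/ai.
    by have q := adapted_quo ad (eqP st); exact q.
  by have r := adapted_res ad (eqP st); exact r.
have key W1 W2 : #|{: 'M[F]_(n1, n2)}|%:R^-1 *
    \sum_y (cross W1 W2)%:R^-1 * \sum_Th f y (glue W1 W2 Th) =
    if stablemx W1 x1 && stablemx W2 x2 then
      hdel2 al (quomx W1 x1) (quomx W2 x2) (resmx W1 x1) (resmx W2 x2) else 0.
  pose g (y : 'M[F]_(n1, n2)) : K :=
    if [&& stablemx W1 x1, stablemx W2 x2 & Z W1 W2 y] then val W1 W2 y else 0.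
  (* The translation by [Th *m x2 - x1 *m Th] is absorbed by reindexing y, so nothing depends on
     [Th] any more. *)
  have gE Th : \sum_y f y (glue W1 W2 Th) = \sum_y g y.
    rewrite [RHS](reindex_inj (addIr (Th *m x2 - x1 *m Th))).
    by apply: eq_bigr => y _; rewrite fE.
  rewrite -big_distrr exchange_big /= (eq_bigr _ (fun Th _ => gE Th)) sumr_const.
  rewrite -[(\sum_y _) *+ _]mulr_natl mulrCA mulKf ?card_mx_neq0 // /g.
  case: (stablemx W1 x1); last by rewrite big1 ?mulr0.
  case: (stablemx W2 x2) => /=; last by rewrite big1 ?mulr0.
  rewrite -big_mkcond /Z /val.
  (* The blocks p and q feed the two coproducts; t occurs in neither argument and contributes only
     its cardinal. *)
  pose h p q (t : 'M[F]_(\rank (cokermx W1), \rank W2)) := al _ _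
    (block_mx (quomx W1 x1) p 0 (quomx W2 x2)) (block_mx (resmx W1 x1) q 0 (resmx W2 x2)).
  rewrite (sum_adapted h (adapted_sub_quo W1) (adapted_sub_quo W2)) card_cross.
  rewrite /hdel2 /hdel !invfM -mulrA; congr (_ * _).
  rewrite big_distrr; apply: eq_bigr => p _ /=.
  rewrite -mulrA; congr (_ * _); rewrite big_distrr; apply: eq_bigr => q _ /=.
  by rewrite /h sumr_const -[(al _ _ _ _) *+ _]mulr_natl mulKf ?card_mx_neq0.
transitivity (#|{: 'M[F]_(n1, n2)}|%:R^-1 * \sum_y
  \sum_(W1 : 'M[F]_n1 | <<W1>>%MS == W1) \sum_(W2 : 'M[F]_n2 | <<W2>>%MS == W2)
    (cross W1 W2)%:R^-1 * \sum_(Th : 'M[F]_(n1, n2)) f y (glue W1 W2 Th)).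
  by congr (_ * _); apply: eq_bigr => y _; rewrite -sum_glue big_mkcondr.
rewrite exchange_big big_distrr /= big_mkcondr; apply: eq_bigr => W1 _.
rewrite exchange_big big_distrr /= big_mkcondr /=.
case: ifP => st1; last by apply: big1 => W2 _; rewrite key st1.
by apply: eq_bigr => W2 _; rewrite key st1.
Qed.

End Mackey.

(** * Hermitian linear algebra: orthogonal projection and extension of operators *)

Section HermitianMatrices.
Variable K : numClosedFieldType.

Definition adjmx m n (A : 'M[K]_(m, n)) : 'M[K]_(n, m) := (map_mx Num.conj A)^T.

Lemma adjmx_mul m n p (A : 'M[K]_(m, n)) (B : 'M[K]_(n, p)) :
  adjmx (A *m B) = adjmx B *m adjmx A.
Proof. by rewrite /adjmx map_mxM trmx_mul. Qed.

(** Each diagonal entry of the Gram matrix is the sum of the squared moduli of a row. *)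
Lemma mulmx_adj_eq0 m n (A : 'M[K]_(m, n)) : A *m adjmx A = 0 -> A = 0.
Proof.
move=> /matrixP A0; apply/matrixP => i j; rewrite mxE.
have := A0 i i; rewrite !mxE => /eqP.
rewrite psumr_eq0 => [/allP /(_ j (mem_index_enum j)) /=|k _].
  by rewrite !mxE mul_conjC_eq0 => /eqP.
by rewrite !mxE mul_conjC_ge0.
Qed.

Lemma mul_gram_eq0 m n p (D : 'M[K]_(p, m)) (A : 'M[K]_(m, n)) :
  D *m A *m adjmx A = 0 -> D *m A = 0.
Proof. by move=> h; apply: mulmx_adj_eq0; rewrite adjmx_mul mulmxA h mul0mx. Qed.

(** The row space of A meets the kernel of its adjoint trivially, so the Gram matrix has the rank of
    A. The matrix [X *m A] is then the orthogonal projector onto the row space. *)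
Lemma orth_projector m n (A : 'M[K]_(m, n)) :
  exists X : 'M[K]_(n, m), X *m A *m adjmx A = adjmx A.
Proof.
suff /submxP [X e] : (adjmx A <= A *m adjmx A)%MS by exists X; rewrite -mulmxA -e.
have rA : \rank (adjmx A) = \rank A by rewrite /adjmx mxrank_tr mxrank_map.
rewrite -(geq_leqif (mxrank_leqif_sup (submxMl A (adjmx A)))) rA.
rewrite -[X in (X <= _)%N](mxrank_mul_ker A (adjmx A)).
rewrite -[X in (_ <= X)%N]addn0 leq_add2l leqn0 mxrank_eq0.
set C := (A :&: kermx (adjmx A))%MS.
have /submxP [D CD] : (C <= A)%MS by apply: capmxSl.
have CK : C *m adjmx A = 0 by apply/sub_kermxP; apply: capmxSr.
by rewrite CD; apply/eqP/mul_gram_eq0; rewrite -CD.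
Qed.

Section Kernels.
Variables I J : finType.
Implicit Types A B : I -> J -> K.

Let mx A := \matrix_(i < #|I|, j < #|J|) A (enum_val i) (enum_val j).

Lemma mxf_mul (e : I -> K) A j :
  ((\row_i e (enum_val i)) *m mx A) 0 (enum_rank j) = \sum_i e i * A i j.
Proof.
rewrite mxE [RHS](reindex_onto enum_val enum_rank) /=; last by move=> i _; rewrite enum_rankK.
apply: eq_big => [i|i _]; first by rewrite enum_valK eqxx.
by rewrite !mxE enum_rankK.
Qed.

Lemma mxf_adj (p : J -> K) A :
  (forall i, \sum_j p j * (A i j)^* = 0) ->
  (\row_j p (enum_val j)) *m adjmx (mx A) = 0.
Proof.
move=> h; apply/rowP => i; rewrite [RHS]mxE -(h (enum_val i)) mxE.
rewrite [RHS](reindex_onto enum_val enum_rank) /=; last by move=> j _; rewrite enum_rankK.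
apply: eq_big => [j|j _]; first by rewrite enum_valK eqxx.
by rewrite !mxE.
Qed.

Lemma orth_decomp A (f : J -> K) :
  exists e : I -> K, exists p : J -> K,
    (forall j, f j = \sum_i e i * A i j + p j) /\
    (forall i, \sum_j p j * (A i j)^* = 0).
Proof.
have [X XA] := orth_projector (mx A); pose v : 'rV_#|J| := \row_j f (enum_val j).
pose w := v - v *m X *m mx A.
have w0 : w *m adjmx (mx A) = 0 by rewrite mulmxBl -!mulmxA (mulmxA X) XA subrr.
exists (fun i => (v *m X) 0 (enum_rank i)), (fun j => w 0 (enum_rank j)).
split=> [j|i].
  rewrite -mxf_mul (_ : \row_i _ = v *m X).
    have vE : v = v *m X *m mx A + w by rewrite addrC subrK.
    have -> : f j = v 0 (enum_rank j) by rewrite mxE enum_rankK.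
    by rewrite {1}vE mxE.
  by apply/rowP => i; rewrite mxE enum_valK.
have := congr1 (fun M : 'M_(_, _) => M 0 (enum_rank i)) w0; rewrite mxE [RHS]mxE => h.
apply: etrans h; rewrite [LHS](reindex_onto enum_val enum_rank) /=; last by move=> j _; rewrite enum_rankK.
apply: eq_big => [j|j _]; first by rewrite enum_valK eqxx.
by rewrite /adjmx /mx enum_valK !mxE enum_rankK.
Qed.

(** Sending each row of A to the corresponding row of B is well defined on the span as soon as the
    relations of A hold for B; the orthogonal complement is free to carry the scalar c. *)
Lemma kernel_extension A B (c : K) :
  (forall e : I -> K, (forall j, \sum_i e i * A i j = 0) ->
                      forall j, \sum_i e i * B i j = 0) ->
  exists k : J -> J -> K,
    (forall (e : I -> K) j,
       \sum_l (\sum_i e i * A i l) * k l j = \sum_i e i * B i j) /\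
    (forall p : J -> K, (forall i, \sum_j p j * (A i j)^* = 0) ->
       forall j, \sum_l p l * k l j = c * p j).
Proof.
move=> AB; have [X XA] := orth_projector (mx A).
have AB' (d : 'rV_#|I|) : d *m mx A = 0 -> d *m mx B = 0.
  pose e i := d 0 (enum_rank i).
  have -> : d = \row_i e (enum_val i) by apply/rowP => i; rewrite mxE /e enum_valK.
  move=> d0; apply/rowP => j; rewrite -(enum_valK j) mxf_mul mxE; apply: AB => l.
  by rewrite -mxf_mul d0 mxE.
(* The first term projects onto the span and applies the assignment; the second is c times the
   complementary projector. *)
pose M := X *m mx B + c *: (1%:M - X *m mx A).
have ME (p : J -> K) j : \sum_l p l * M (enum_rank l) (enum_rank j) =
    ((\row_l p (enum_val l)) *m M) 0 (enum_rank j).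
  rewrite mxE [LHS](reindex_onto enum_val enum_rank) /=; last by move=> i _; rewrite enum_rankK.
  apply: eq_big => [i|i _]; first by rewrite enum_valK eqxx.
  by rewrite mxE enum_valK.
exists (fun l j => M (enum_rank l) (enum_rank j)); split=> [e j|p p0 j].
  rewrite ME -mxf_mul; set v := \row_i e (enum_val i).
  have -> : \row_l (\sum_i e i * A i (enum_val l)) = v *m mx A.
    by apply/rowP => l; rewrite mxE -mxf_mul enum_valK.
  have d0 : (v - v *m mx A *m X) *m mx A = 0.
    by apply: mul_gram_eq0; rewrite !mulmxBl -!mulmxA (mulmxA X) XA subrr.
  have := AB' _ d0; rewrite mulmxBl => /eqP; rewrite subr_eq0 => /eqP ->.
  rewrite /M mulmxDr -scalemxAr mulmxBr mulmx1 !mulmxA.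
  by move: d0; rewrite mulmxBl => ->; rewrite scaler0 addr0.
rewrite ME; set v := \row_j p (enum_val j); have v0 : v *m adjmx (mx A) = 0 by apply: mxf_adj.
have d0 : v *m X *m mx A = 0 by apply: mul_gram_eq0; rewrite -!mulmxA (mulmxA X) XA v0.
rewrite /M mulmxDr -scalemxAr mulmxBr mulmx1 !mulmxA d0 (AB' _ d0) subr0 add0r.
by rewrite !mxE enum_rankK.
Qed.

End Kernels.
End HermitianMatrices.

(** * Operators compatible with product and coproduct below a given degree *)

Section Operators.
Variables (F : finFieldType) (K : numClosedFieldType).
Local Notation fun1 := (fun1 F K).
Local Notation fun2 := (fun2 F K).

(** With kernels, an operator is a finite sum, which commutes with the sums of [hmul] and [hdel] in
    another variable, and its degrees can be prescribed one at a time. *)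
Definition kerfam := forall n, 'M[F]_n -> 'M[F]_n -> K.

Definition app (k : kerfam) (a : fun1) : fun1 :=
  fun n x => \sum_(y : 'M[F]_n) a n y * k n y x.

Definition app2 (k : kerfam) (al : fun2) : fun2 :=
  fun m n x1 x2 => app k (fun m y1 => app k (fun n y2 => al m n y1 y2) x2) x1.

Lemma app_ext k (a b : fun1) n (x : 'M[F]_n) :
  (forall y, a n y = b n y) -> app k a x = app k b x.
Proof. by move=> e; apply: eq_bigr => y _; rewrite e. Qed.

Lemma app2_ext k (al be : fun2) m n (x1 : 'M[F]_m) (x2 : 'M[F]_n) :
  (forall y z, al m n y z = be m n y z) -> app2 k al x1 x2 = app2 k be x1 x2.
Proof. by move=> e; apply: app_ext => y; apply: app_ext => z. Qed.

Lemma app_sum k I (r : seq I) (P : pred I) (a : I -> fun1) n (x : 'M[F]_n) :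
  app k (fun n y => \sum_(i <- r | P i) a i n y) x =
  \sum_(i <- r | P i) app k (a i) x.
Proof. by rewrite /app exchange_big /=; apply: eq_bigr => y _; rewrite big_distrl. Qed.

Lemma app_scale k c (a : fun1) n (x : 'M[F]_n) :
  app k (fun n y => c * a n y) x = c * app k a x.
Proof. by rewrite /app big_distrr /=; apply: eq_bigr => y _; rewrite mulrA. Qed.

Lemma app_add k (a b : fun1) n (x : 'M[F]_n) :
  app k (fun n y => a n y + b n y) x = app k a x + app k b x.
Proof. by rewrite /app -big_split /=; apply: eq_bigr => y _; rewrite mulrDl. Qed.

Lemma app0 k (a : fun1) n (x : 'M[F]_n) : (forall y, a n y = 0) -> app k a x = 0.
Proof. by move=> e; apply: big1 => y _; rewrite e mul0r. Qed.

Lemma app_swap k (al : fun2) m n (x1 : 'M[F]_m) (x2 : 'M[F]_n) :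
  app k (fun m y1 => app k (fun n y2 => al m n y1 y2) x2) x1 =
  app k (fun n y2 => app k (fun m y1 => al m n y1 y2) x1) x2.
Proof.
rewrite /app; under eq_bigr do rewrite big_distrl /=.
rewrite exchange_big; apply: eq_bigr => y _; rewrite big_distrl.
by apply: eq_bigr => z _; rewrite mulrAC.
Qed.

Lemma app_hdel k (al : fun2) m n1 n2 (u : 'M[F]_m) (x1 : 'M[F]_n1) (x2 : 'M[F]_n2) :
  hdel (fun n v => app k (fun m y => al m n y v) u) x1 x2 =
  app k (fun m y => hdel (fun n v => al m n y v) x1 x2) u.
Proof. by rewrite app_scale app_sum. Qed.

Lemma app_hmul k (al : forall m n p, 'M[F]_m -> 'M[F]_n -> 'M[F]_p -> K)
    m n (u : 'M[F]_m) (x : 'M[F]_n) :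
  app k (fun m y => hmul (fun a b q s => al m a b y q s) x) u =
  hmul (fun a b q s => app k (fun m y => al m a b y q s) u) x.
Proof. exact: app_sum. Qed.

Lemma hdel_ext (a b : fun1) n1 n2 (x1 : 'M[F]_n1) (x2 : 'M[F]_n2) :
  (forall y, a (n1 + n2)%N y = b (n1 + n2)%N y) -> hdel a x1 x2 = hdel b x1 x2.
Proof. by move=> e; congr (_ * _); apply: eq_bigr => y _; rewrite e. Qed.

Lemma rank_cokerD n (W : 'M[F]_n) : (\rank (cokermx W) + \rank W)%N = n.
Proof. by rewrite mxrank_coker subnK // rank_leq_row. Qed.

Lemma hmul_ext (al be : fun2) n (x : 'M[F]_n) :
  (forall a b (q : 'M[F]_a) (s : 'M[F]_b), (a + b)%N = n -> al a b q s = be a b q s) ->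
  hmul al x = hmul be x.
Proof. by move=> e; apply: eq_bigr => W _; apply/e/rank_cokerD. Qed.

Lemma inv2l (al : fun2) n (v : 'M[F]_n) : inv2 al -> inv1 (fun m u => al m n u v).
Proof. by move=> ai m m' u u' uu; apply: ai uu (hsim_refl v). Qed.

Lemma inv2r (al : fun2) m (u : 'M[F]_m) : inv2 al -> inv1 (fun n v => al m n u v).
Proof. by move=> ai n n' v v' vv; apply: ai (hsim_refl u) vv. Qed.

Lemma inv2W (al : fun2) :
  (forall n (v : 'M[F]_n), inv1 (fun m u => al m n u v)) ->
  (forall m (u : 'M[F]_m), inv1 (fun n v => al m n u v)) -> inv2 al.
Proof.
move=> h1 h2 m m' n n' u u' v v' uu vv.
by rewrite (h1 n v m m' u u' uu) (h2 m' u' n n' v v' vv).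
Qed.

Definition inv_preserving k := forall a, inv1 a -> inv1 (app k a).

Lemma app2_inv k al : inv_preserving k -> inv2 al -> inv2 (app2 k al).
Proof.
move=> kp ai; apply: inv2W => n v.
  apply: (kp (fun m y1 => app k (fun n y2 => al m n y1 y2) v)).
  by move=> m m' u u' uu; apply: app_ext => y; apply: ai uu (hsim_refl y).
move=> p p' w w' ww; rewrite /app2 [LHS]app_swap [RHS]app_swap.
apply: (kp (fun m y1 => app k (fun n y2 => al n m y2 y1) v)) ww.
by move=> m m' u u' uu; apply: app_ext => y; apply: ai (hsim_refl y) uu.
Qed.

Lemma hdel2_inv (al : fun2) a b c d a' b' c' d' (q1 : 'M[F]_a) (q2 : 'M[F]_b)
    (s1 : 'M[F]_c) (s2 : 'M[F]_d) (q1' : 'M[F]_a') (q2' : 'M[F]_b')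
    (s1' : 'M[F]_c') (s2' : 'M[F]_d') : inv2 al ->
  hsim q1 q1' -> hsim q2 q2' -> hsim s1 s1' -> hsim s2 s2' ->
  hdel2 al q1 q2 s1 s2 = hdel2 al q1' q2' s1' s2'.
Proof.
move=> ai h1 h2 h3 h4; transitivity (hdel2 al q1' q2' s1 s2).
  apply: hdel_inv h1 h2 => m m' u u' uu; apply: hdel_ext => y.
  exact: ai uu (hsim_refl y).
by apply: hdel_ext => y; apply: (hdel_inv (inv2r y ai)).
Qed.

(** The tensor square of the augmentation ideal: in total degree N both factors have degree below
    N. *)
Definition reduced (al : fun2) := forall m n (u : 'M[F]_m) (v : 'M[F]_n),
  ~~ ((0 < m) && (0 < n))%N -> al m n u v = 0.

Lemma app2_reduced k al : reduced al -> reduced (app2 k al).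
Proof. by move=> ap m n u v mn; apply: app0 => y; apply: app0 => z; apply: ap. Qed.

Definition comult_compat (k : kerfam) N := forall a : fun1, inv1 a ->
  forall n1 n2, (n1 + n2)%N = N -> forall (x1 : 'M[F]_n1) (x2 : 'M[F]_n2),
  hdel (app k a) x1 x2 = app2 k (hdel a) x1 x2.

Definition mult_compat (k : kerfam) N := forall al : fun2, inv2 al ->
  forall x : 'M[F]_N, app k (hmul al) x = hmul (app2 k al) x.

Definition primitive N (z : fun1) := forall n1 n2,
  (0 < n1)%N -> (0 < n2)%N -> (n1 + n2)%N = N ->
  forall (x1 : 'M[F]_n1) (x2 : 'M[F]_n2), hdel z x1 x2 = 0.

(** Both tensor factors have degree below N, so compatibility with the coproduct applies to each in
    turn; the rest is the commutation of operators acting on different variables. *)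
Lemma hdel2_app2 k N al a b c d (q1 : 'M[F]_a) (q2 : 'M[F]_b)
    (s1 : 'M[F]_c) (s2 : 'M[F]_d) :
  inv_preserving k -> (forall n, (n < N)%N -> comult_compat k n) -> inv2 al ->
  (a + b < N)%N -> (c + d < N)%N ->
  hdel2 (app2 k al) q1 q2 s1 s2 =
  app2 k (fun a b q1 q2 =>
    app2 k (fun c d s1 s2 => hdel2 al q1 q2 s1 s2) s1 s2) q1 q2.
Proof.
move=> kp kc ai ab cd; rewrite /hdel2.
pose b0 : fun1 := fun m y => app2 k (hdel (fun n v => al m n y v)) s1 s2.
have E m (u : 'M[F]_m) : hdel (fun n v => app2 k al u v) s1 s2 = app k b0 u.
  pose au : fun1 := fun n z => app k (fun m y => al m n y z) u.
  have aui : inv1 au.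
    by move=> n n' z z' zz; apply: app_ext => y; apply: ai (hsim_refl y) zz.
  rewrite (hdel_ext (b := app k au)); last by move=> y; apply: app_swap.
  rewrite (kc _ cd _ aui _ _ erefl).
  rewrite (@app2_ext k _ (fun c d z1 z2 =>
     app k (fun m y => hdel (fun n v => al m n y v) z1 z2) u)); last first.
    by move=> y z; apply: app_hdel.
  rewrite {1}/app2 /b0 /app2 [RHS]app_swap; apply: app_ext => y.
  exact: (app_swap k (fun n m y2 y1 => hdel (fun n v => al m n y1 v) y y2) s2 u).
rewrite (hdel_ext (b := app k b0)) //.
have bi : inv1 b0.
  move=> m m' y y' yy; apply: app2_ext => z1 z2; apply: hdel_ext => v.
  exact: ai yy (hsim_refl v).
rewrite (kc _ ab _ bi _ _ erefl); apply: app2_ext => y z; rewrite /b0 /app2.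
rewrite (app_hdel k (fun m n y1 v => app k (fun n0 y2 => hdel (fun n1 v0 => al n n1 v v0) y1 y2) s2)).
by apply: app_ext => w; rewrite app_hdel.
Qed.

(** Multiplicativity in the degrees n1 and n2, one tensor factor at a time; [h] stands for the
    double coproduct of the Mackey formula. *)
Lemma app2_mackey k N (h : forall a b c d, 'M[F]_a -> 'M[F]_b -> 'M[F]_c -> 'M[F]_d -> K)
    n1 n2 (x1 : 'M[F]_n1) (x2 : 'M[F]_n2) :
  inv_preserving k -> (forall n, (n < N)%N -> mult_compat k n) ->
  (forall a b c d a' b' c' d' (q1 : 'M[F]_a) (q2 : 'M[F]_b)
    (s1 : 'M[F]_c) (s2 : 'M[F]_d) (q1' : 'M[F]_a') (q2' : 'M[F]_b')
    (s1' : 'M[F]_c') (s2' : 'M[F]_d'),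
  hsim q1 q1' -> hsim q2 q2' -> hsim s1 s1' -> hsim s2 s2' ->
  h _ _ _ _ q1 q2 s1 s2 = h _ _ _ _ q1' q2' s1' s2') ->
  (n1 < N)%N -> (n2 < N)%N ->
  app2 k (fun n1 n2 y1 y2 =>
    hmul (fun a c q1 s1 => hmul (fun b d q2 s2 => h a b c d q1 q2 s1 s2) y2) y1) x1 x2 =
  hmul (fun a c q1 s1 => hmul (fun b d q2 s2 =>
    app2 k (fun a c q1 s1 => app2 k (fun b d q2 s2 => h a b c d q1 q2 s1 s2) q2 s2) q1 s1) x2) x1.
Proof.
move=> kp km hi l1 l2; rewrite /app2.
pose L : fun2 := fun a c q1 s1 =>
  hmul (app2 k (fun b d q2 s2 => h a b c d q1 q2 s1 s2)) x2.
have Li : inv2 L.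
  move=> m m' n n' u u' v v' uu vv; apply: hmul_ext => a b q s _.
  by apply: app2_ext => y z; apply: hi; rewrite ?hsim_refl.
transitivity (app k (fun n y => hmul L y) x1).
  apply: app_ext => y.
  rewrite (app_hmul k (fun m a b y q s => hmul (fun b0 d q2 s2 => h a b0 b d q q2 s s2) y) x2 y).
  apply: hmul_ext => a b q s _ /=.
  apply: (km _ l2 (fun b0 d q2 s2 => h a b0 b d q q2 s s2)).
  by move=> m m' n n' u u' v v' uu vv; apply: hi; rewrite ?hsim_refl.
rewrite (km _ l1 _ Li); apply: hmul_ext => a b q s _; rewrite /app2 /L.
rewrite -(app_hmul k (fun m b0 d y1 q2 s2 => app k (fun n y0 =>
    app2 k (fun b1 d0 q3 s3 => h m b1 n d0 y1 q3 y0 s3) q2 s2) s)).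
by apply: app_ext => y; rewrite -app_hmul.
Qed.

Lemma hdel_hmul_app2 k N al n1 n2 (x1 : 'M[F]_n1) (x2 : 'M[F]_n2) :
  inv_preserving k -> (forall n, (n < N)%N -> comult_compat k n) ->
  (forall n, (n < N)%N -> mult_compat k n) ->
  inv2 al -> reduced al -> (0 < n1)%N -> (0 < n2)%N -> (n1 + n2)%N = N ->
  hdel (hmul (app2 k al)) x1 x2 = app2 k (hdel (hmul al)) x1 x2.
Proof.
move=> kp kc km ai ap p1 p2 eN.
rewrite (hdel_hmul _ _ (app2_inv kp ai)).
rewrite [RHS](@app2_ext k _ (fun n1 n2 y1 y2 =>
    hmul (fun a c q1 s1 => hmul (fun b d q2 s2 => hdel2 al q1 q2 s1 s2) y2) y1)); last first.
  by move=> y z; rewrite hdel_hmul.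
rewrite (@app2_mackey k N (fun a b c d q1 q2 s1 s2 => hdel2 al q1 q2 s1 s2)) //; first last.
- by rewrite -eN -[X in (X < _)%N]add0n ltn_add2r.
- by rewrite -eN -[X in (X < _)%N]addn0 ltn_add2l.
- by move=> *; apply: hdel2_inv.
apply: eq_bigr => W1 _; apply: eq_bigr => W2 _.
have e1 := rank_cokerD W1; have e2 := rank_cokerD W2.
have eT : (\rank (cokermx W1) + \rank (cokermx W2) + (\rank W1 + \rank W2) = N)%N.
  by rewrite addnACA e1 e2.
(* If both quotients or both subspaces are zero, [al] vanishes because it is reduced. Otherwise the
   quotients together, and the subspaces together, have dimension below N. *)
have [pq|] := boolP ((0 < \rank (cokermx W1) + \rank (cokermx W2)) && (0 < \rank W1 + \rank W2))%N; last first.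
  move=> np; have z0 q1 q2 s1 s2 : hdel2 al (q1 : 'M[F]_(\rank (cokermx W1)))
      (q2 : 'M[F]_(\rank (cokermx W2))) (s1 : 'M[F]_(\rank W1)) (s2 : 'M[F]_(\rank W2)) = 0.
    rewrite /hdel2 /hdel big1 ?mulr0 // => y _; rewrite big1 ?mulr0 // => y' _.
    exact: ap.
  rewrite /hdel2 /hdel big1 ?mulr0 => [|y _]; last first.
    by rewrite big1 ?mulr0 // => y' _; apply: (app2_reduced k ap).
  by apply/esym; apply: app0 => y; apply: app0 => y2; apply: app0 => y3; apply: app0 => y4; exact: z0.
case/andP: pq => pq ps.
rewrite (hdel2_app2 _ _ _ _ kp kc ai); first last.
- by rewrite -eT -[X in (X < _)%N]add0n ltn_add2r.
- by rewrite -eT -[X in (X < _)%N]addn0 ltn_add2l.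
apply: app_ext => y.
exact: (app_swap k (fun b c q2 s1 => app k (fun d s2 => hdel2 al y q2 s1 s2) (resmx W2 x2))).
Qed.

End Operators.

(** * Primitive functions and orthogonality *)

Section Primitives.
Variables (F : finFieldType) (K : numClosedFieldType).
Local Notation fun1 := (fun1 F K).
Local Notation fun2 := (fun2 F K).

(** By [hmul_pairing] the sum pairs [hdel z] with [be]: the former vanishes in positive degrees, the
    latter elsewhere. *)
Lemma primitive_orth N (z : fun1) (be : fun2) :
  inv1 z -> primitive N z -> reduced be ->
  \sum_(x : 'M[F]_N) z N x * hmul be x = 0.
Proof.
move=> zi zp bp; rewrite hmul_pairing // big1 // => W _.
rewrite big1 ?mulr0 // => v _; rewrite big1 // => u _.
have [/andP [p1 p2]|np] := boolP ((0 < \rank (cokermx W)) && (0 < \rank W))%N.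
  by rewrite zp ?mul0r // rank_cokerD.
by rewrite bp ?mulr0.
Qed.

Lemma hmul_conj (be : fun2) N (x : 'M[F]_N) :
  (hmul be x)^* = hmul (fun m n u v => (be m n u v)^*) x.
Proof. exact: rmorph_sum. Qed.

Lemma primitive_hmul_eq0 N (z : fun1) (be : fun2) :
  inv1 z -> primitive N z -> reduced be -> (forall x : 'M[F]_N, z N x = hmul be x) ->
  forall x : 'M[F]_N, z N x = 0.
Proof.
move=> zi zp bp zb x; have : \sum_(x : 'M[F]_N) z N x * (z N x)^* = 0.
  under eq_bigr do rewrite {2}zb hmul_conj.
  by apply: primitive_orth => // m n u v mn; rewrite bp // conjC0.
move/eqP; rewrite psumr_eq0 => [/allP /(_ x (mem_index_enum x)) /=|y _].
  by rewrite mul_conjC_eq0 => /eqP.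
exact: mul_conjC_ge0.
Qed.

Definition trunc (al : fun2) : fun2 := fun m n u v =>
  if ((0 < m) && (0 < n))%N then al m n u v else 0.

Lemma trunc_inv al : inv2 al -> inv2 (trunc al).
Proof.
move=> ai m m' n n' u u' v v' uu vv; have e1 := hsim_dim uu; have e2 := hsim_dim vv; subst m' n'.
by rewrite /trunc (ai _ _ _ _ _ _ _ _ uu vv).
Qed.

Lemma trunc_reduced al : reduced (trunc al).
Proof. by move=> m n u v mn; rewrite /trunc (negPf mn). Qed.

(** Testing against the truncated coproduct of z itself turns the pairing into a positively weighted
    sum of squared moduli over all subspaces, so every term is 0. *)
Lemma orth_primitive N (z : fun1) : inv1 z ->
  (forall be : fun2, inv2 be -> reduced be ->
     \sum_(x : 'M[F]_N) z N x * (hmul be x)^* = 0) ->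
  primitive N z.
Proof.
move=> zi zo n1 n2 p1 p2 eN x1 x2; subst N.
have := zo _ (trunc_inv (hdel_inv zi)) (@trunc_reduced (hdel z)).
under eq_bigr do rewrite hmul_conj.
rewrite hmul_pairing //.
have t_ge0 (W : 'M[F]_(n1 + n2)) (v : 'M[F]_(\rank (cokermx W))) (u : 'M[F]_(\rank W)) :
    0 <= hdel z v u * (trunc (hdel z) v u)^*.
  by rewrite /trunc; case: ifP => _; rewrite ?mul_conjC_ge0 // conjC0 mulr0.
pose W := <<row_mx 0 1%:M : 'M[F]_(n2, n1 + n2)>>%MS.
have rW : \rank W = n2.
  by rewrite mxrank_gen rank_row_0mx mxrank1.
have cW : \rank (cokermx W) = n1 by rewrite mxrank_coker rW addnK.
(* The term of the subspace [W] spanned by the last n2 coordinates is the wanted value, once x1 and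
   x2 are transported to the sizes [\rank (cokermx W)] and [\rank W]. *)
have [v1 s1] := hsim_exists_eq x1 (esym cW); have [v2 s2] := hsim_exists_eq x2 (esym rW).
rewrite (hdel_inv zi s1 s2) => /eqP.
rewrite psumr_eq0 => [/allP /(_ W (mem_index_enum W))|U _]; last first.
  by rewrite mulr_ge0 ?ler0n // sumr_ge0 // => v _; rewrite sumr_ge0.
rewrite genmx_id eqxx /= mulf_eq0 (negPf (card_mx_neq0 _ _ _ _)) /=.
rewrite psumr_eq0 => [/allP /(_ v1 (mem_index_enum v1)) /=|v _]; last first.
  by rewrite sumr_ge0.
rewrite psumr_eq0 // => /allP /(_ v2 (mem_index_enum v2)) /=.
have q1 : (0 < \rank (cokermx W))%N by rewrite cW.
have q2 : (0 < \rank W)%N by rewrite rW.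
by rewrite /trunc q1 q2 /= mul_conjC_eq0 => /eqP.
Qed.

End Primitives.

(** * A finite spanning family in bounded degree *)

Section Atoms.
Variables (F : finFieldType) (K : numClosedFieldType) (N : nat).
Local Notation fun1 := (fun1 F K).
Local Notation fun2 := (fun2 F K).

(** Bounding the size gives a finite index type, as the matrix lemmas on kernels require. *)
Definition sqmx := {i : 'I_N.+1 & 'M[F]_i}.

Definition simclass n (u : 'M[F]_n) := [pred t : sqmx | hsim u (tagged t)].

(* Indicator of the similarity class of s, normalized so that summing over all
   matrices, rather than over classes, decomposes an invariant function. *)
Definition atom (s : sqmx) : fun1 := fun n u =>
  if hsim u (tagged s) then #|simclass u|%:R^-1 else 0.

Lemma hsim_iff m n (u : 'M[F]_m) (v : 'M[F]_n) p (w : 'M[F]_p) :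
  hsim u v -> hsim u w = hsim v w.
Proof.
move=> uv; apply/idP/idP; last exact: hsim_trans uv.
by rewrite hsim_sym in uv; apply: hsim_trans uv.
Qed.

Lemma atom_inv s : inv1 (atom s).
Proof.
move=> m n u v uv; rewrite /atom (hsim_iff _ uv); case: ifP => // _.
by congr (_%:R^-1); apply: eq_card => t; rewrite !inE (hsim_iff _ uv).
Qed.

Lemma atom_sum (a : fun1) n (u : 'M[F]_n) : inv1 a -> (n <= N)%N ->
  \sum_s a _ (tagged s) * atom s u = a n u.
Proof.
move=> ai nN.
rewrite (eq_bigr (fun s : sqmx => if hsim u (tagged s) then a n u / #|simclass u|%:R else 0)).
  rewrite -big_mkcond (eq_bigl (fun s => s \in simclass u)) ?sumr_const //.
  rewrite -[_ *+ _]mulr_natr divfK // pnatr_eq0 -lt0n; apply/card_gt0P.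
  have lt : (n < N.+1)%N by [].
  by exists (Tagged (fun i : 'I_N.+1 => 'M[F]_i) (u : 'M[F]_(Ordinal lt))); rewrite inE hsim_refl.
move=> s _; rewrite /atom; case: ifP => [h|_]; last by rewrite mulr0.
by rewrite (ai _ _ _ _ h).
Qed.

Definition atom2 (st : sqmx * sqmx) : fun2 :=
  trunc (fun m n u v => atom st.1 u * atom st.2 v).

Lemma atom2_inv st : inv2 (atom2 st).
Proof.
apply: trunc_inv => m m' n n' u u' v v' uu vv.
by rewrite (atom_inv st.1 uu) (atom_inv st.2 vv).
Qed.

Definition comb (e : sqmx * sqmx -> K) : fun2 := fun m n u v =>
  \sum_st e st * atom2 st u v.

Lemma comb_inv e : inv2 (comb e).
Proof.
move=> m m' n n' u u' v v' uu vv; apply: eq_bigr => st _.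
by rewrite (atom2_inv st uu vv).
Qed.

Lemma comb_reduced e : reduced (comb e).
Proof. by move=> m n u v mn; apply: big1 => st _; rewrite /atom2 trunc_reduced ?mulr0. Qed.

Definition coefs (al : fun2) : sqmx * sqmx -> K :=
  fun st => al _ _ (tagged st.1) (tagged st.2).

(** This makes the decomposable functions of degree N the span of finitely many products of
    atoms. *)
Lemma comb_coefs (al : fun2) m n (u : 'M[F]_m) (v : 'M[F]_n) :
  inv2 al -> reduced al -> (m <= N)%N -> (n <= N)%N ->
  comb (coefs al) u v = al m n u v.
Proof.
move=> ai ap mN nN; rewrite /comb /atom2 /trunc.
case: (boolP (_ && _)) => [_|np]; last first.
  by rewrite ap // big1 // => st _; rewrite mulr0.
rewrite -(pair_bigA _ (fun s t => al _ _ (tagged s) (tagged t) * (atom s u * atom t v))) /=.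
rewrite -(atom_sum u (inv2l v ai) mN); apply: eq_bigr => s _.
rewrite -(atom_sum v (inv2r (tagged s) ai) nN) big_distrl; apply: eq_bigr => t _ /=.
by rewrite mulrA mulrAC.
Qed.

Lemma hmul_comb e n (x : 'M[F]_n) : hmul (comb e) x = \sum_st e st * hmul (atom2 st) x.
Proof.
rewrite /hmul exchange_big; apply: eq_bigr => st _ /=.
by rewrite big_distrr.
Qed.

Lemma app2_comb k e m n (u : 'M[F]_m) (v : 'M[F]_n) :
  app2 k (comb e) u v = \sum_st e st * app2 k (atom2 st) u v.
Proof.
rewrite /app2 /comb.
under eq_bigr do rewrite -app_scale.
rewrite -app_sum; apply: app_ext => y.
under eq_bigr do rewrite -app_scale.
exact: app_sum.
Qed.

Lemma hmul_app2_comb k e n (x : 'M[F]_n) :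
  hmul (app2 k (comb e)) x = \sum_st e st * hmul (app2 k (atom2 st)) x.
Proof.
rewrite /hmul; under eq_bigr do rewrite app2_comb.
rewrite exchange_big; apply: eq_bigr => st _ /=.
by rewrite big_distrr.
Qed.

Lemma hmul_coefs (al : fun2) (x : 'M[F]_N) : inv2 al -> reduced al ->
  hmul al x = hmul (comb (coefs al)) x.
Proof.
move=> ai ap; apply: hmul_ext => a b q s e.
by rewrite comb_coefs // -e ?leq_addr ?leq_addl.
Qed.

Lemma hmul_app2_coefs k (al : fun2) (x : 'M[F]_N) : inv2 al -> reduced al ->
  hmul (app2 k al) x = hmul (app2 k (comb (coefs al))) x.
Proof.
move=> ai ap; apply: hmul_ext => a b q s e; apply: app2_ext => y z.
by rewrite comb_coefs // -e ?leq_addr ?leq_addl.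
Qed.

(** Degree N of [a] is projected orthogonally onto the span of the products of atoms; the remainder
    is orthogonal to all decomposables, hence primitive. *)
Lemma primitive_decomp (a : fun1) : inv1 a ->
  exists e : sqmx * sqmx -> K,
    primitive N (fun n x => a n x - hmul (comb e) x).
Proof.
move=> ai.
have [e [p [ap po]]] := orth_decomp (fun st (x : 'M[F]_N) => hmul (atom2 st) x) (a N).
exists e; apply: orth_primitive => [m n u v uv|be bi bp].
  by rewrite (ai _ _ _ _ uv) (hmul_inv (comb_inv e) uv).
rewrite (eq_bigr (fun x => p x * (hmul be x)^*)) => [|x _]; last first.
  by rewrite ap hmul_comb addrAC subrr add0r.
under eq_bigr do rewrite hmul_coefs // hmul_comb rmorph_sum big_distrr /=.
rewrite exchange_big big1 // => st _ /=.
transitivity ((coefs be st)^* * \sum_x p x * (hmul (atom2 st) x)^*).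
  by rewrite big_distrr /=; apply: eq_bigr => x _; rewrite rmorphM mulrCA.
by rewrite po mulr0.
Qed.

End Atoms.

(** * The operator in the next degree, and the terms of degree 0 *)

Section Extension.
Variables (F : finFieldType) (K : numClosedFieldType).
Local Notation fun1 := (fun1 F K).
Local Notation fun2 := (fun2 F K).
Local Notation kerfam := (kerfam F K).

Lemma hmul_app2_eq0 (k : kerfam) N (al : fun2) :
  inv_preserving k -> (forall n, (n < N)%N -> comult_compat k n) ->
  (forall n, (n < N)%N -> mult_compat k n) -> inv2 al -> reduced al ->
  (forall x : 'M[F]_N, hmul al x = 0) ->
  forall x : 'M[F]_N, hmul (app2 k al) x = 0.
Proof.
move=> kp kc km ai ap al0.
apply: (@primitive_hmul_eq0 _ _ N (hmul (app2 k al)) (app2 k al)) => //.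
- exact/hmul_inv/app2_inv.
- move=> n1 n2 p1 p2 eN x1 x2; rewrite (hdel_hmul_app2 _ _ kp kc km) //; subst N.
  apply: app0 => y; apply: app0 => z; rewrite /hdel big1 ?mulr0 //.
- exact: app2_reduced.
Qed.

Definition scalar_on_primitives (c : K) (k : kerfam) N := forall z : fun1,
  inv1 z -> primitive N z -> forall x : 'M[F]_N, app k z x = c * z N x.

(** [kernel_extension] sends products of atoms to products of their images; its hypothesis on
    relations is [hmul_app2_eq0]. *)
Lemma exists_kernel (c : K) (k : kerfam) N :
  inv_preserving k -> (forall n, (n < N)%N -> comult_compat k n) ->
  (forall n, (n < N)%N -> mult_compat k n) ->
  exists kN : 'M[F]_N -> 'M[F]_N -> K,
    (forall al : fun2, inv2 al -> reduced al -> forall x : 'M[F]_N,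
       \sum_y hmul al y * kN y x = hmul (app2 k al) x) /\
    (forall z : fun1, inv1 z -> primitive N z -> forall x : 'M[F]_N,
       \sum_y z N y * kN y x = c * z N x).
Proof.
move=> kp kc km.
pose A (st : sqmx F N * sqmx F N) (x : 'M[F]_N) := hmul (atom2 K st) x.
pose B (st : sqmx F N * sqmx F N) (x : 'M[F]_N) := hmul (app2 k (atom2 K st)) x.
have [|kN [kA kp0]] := @kernel_extension K _ _ A B c.
  move=> e e0 x; rewrite -(hmul_app2_comb k e); apply: hmul_app2_eq0 => //.
  - exact: comb_inv.
  - exact: comb_reduced.
  - by move=> y; rewrite hmul_comb; apply: e0.
exists kN; split=> [al ai ap x|z zi zp x].
  rewrite hmul_app2_coefs // hmul_app2_comb -kA; apply: eq_bigr => y _.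
  by rewrite hmul_coefs // hmul_comb.
apply: kp0 => st.
under eq_bigr do rewrite hmul_conj.
by apply: primitive_orth => // m n u v mn; rewrite /atom2 trunc_reduced ?conjC0.
Qed.

Lemma app_agree (k k' : kerfam) (a : fun1) n (x : 'M[F]_n) :
  (forall y, k n y x = k' n y x) -> app k a x = app k' a x.
Proof. by move=> e; apply: eq_bigr => y _; rewrite e. Qed.

Lemma app2_agree (k k' : kerfam) (al : fun2) m n (x1 : 'M[F]_m) (x2 : 'M[F]_n) :
  (forall y, k m y x1 = k' m y x1) -> (forall y, k n y x2 = k' n y x2) ->
  app2 k al x1 x2 = app2 k' al x1 x2.
Proof.
move=> e1 e2; rewrite /app2 (app_agree _ e1); apply: app_ext => y.
exact: app_agree.
Qed.

Definition agree (k k' : kerfam) N := forall m, (m <= N)%N ->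
  forall y x : 'M[F]_m, k m y x = k' m y x.

Lemma hmul_app2_agree k k' (al : fun2) N (x : 'M[F]_N) : agree k k' N ->
  hmul (app2 k al) x = hmul (app2 k' al) x.
Proof.
move=> kk; apply: hmul_ext => a b q s e; apply: app2_agree => y; apply: kk.
  by rewrite -e leq_addr.
by rewrite -e leq_addl.
Qed.

Lemma comult_compat_agree k k' N :
  agree k k' N -> comult_compat k N -> comult_compat k' N.
Proof.
move=> kk kc a ai n1 n2 e x1 x2.
rewrite -(@app2_agree k) => [|y|y]; last first.
- by apply: kk; rewrite -e leq_addl.
- by apply: kk; rewrite -e leq_addr.
rewrite -(kc _ ai _ _ e); apply: hdel_ext => y.
by apply/esym/app_agree => z; apply: kk; rewrite e.
Qed.

Lemma mult_compat_agree k k' N :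
  agree k k' N -> mult_compat k N -> mult_compat k' N.
Proof.
move=> kk km al ai x; rewrite -(hmul_app2_agree _ _ kk) -km //.
by apply/esym/app_agree => z; apply: kk.
Qed.

Lemma scalar_on_primitives_agree c k k' N :
  agree k k' N -> scalar_on_primitives c k N -> scalar_on_primitives c k' N.
Proof.
by move=> kk kc z zi zp x; rewrite -kc //; apply/esym/app_agree => y; apply: kk.
Qed.

Definition normalized (k : kerfam) := forall y x : 'M[F]_0, k 0%N y x = 1.

Lemma mx00 (x : 'M[F]_0) : x = 0. Proof. by apply/matrixP => - []. Qed.

Lemma app_deg0 k (a : fun1) (x : 'M[F]_0) : normalized k -> app k a x = a 0%N x.
Proof.
move=> k0; rewrite /app (bigD1 x) //= k0 mulr1 big1 ?addr0 // => y.
by rewrite [y]mx00 [x]mx00 eqxx.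
Qed.

Lemma hsim_block0l n (x1 : 'M[F]_0) (x2 : 'M[F]_n) y : hsim x2 (block_mx x1 y 0 x2).
Proof.
apply/hsimP; exists (row_mx 0 1%:M), (col_mx 0 1%:M); split.
- by rewrite mul_row_col mulmx0 mulmx1 add0r.
- rewrite mul_col_row !mul0mx mulmx0 mulmx1 [RHS]scalar_mx_block.
  by rewrite [1%:M in RHS]mx00.
- by rewrite mul_mx_row mul_row_block !mulmx0 !mul0mx mulmx1 mul1mx !add0r.
Qed.

Lemma hsim_block0r n (x1 : 'M[F]_n) (x2 : 'M[F]_0) y : hsim x1 (block_mx x1 y 0 x2).
Proof.
apply/hsimP; exists (row_mx 1%:M 0), (col_mx 1%:M 0); split.
- by rewrite mul_row_col mul0mx mulmx1 addr0.
- rewrite mul_col_row !mulmx0 mulmx1 mul0mx [RHS]scalar_mx_block.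
  by congr block_mx; rewrite [RHS]mx00.
- rewrite mul_mx_row mul_row_block !mulmx0 !mul0mx mulmx1 mul1mx !addr0 mul1mx.
  by rewrite [y]thinmx0.
Qed.

Lemma hdel_deg0l (a : fun1) n (x1 : 'M[F]_0) (x2 : 'M[F]_n) :
  inv1 a -> hdel a x1 x2 = a n x2.
Proof.
move=> ai; rewrite /hdel (eq_bigr (fun=> a n x2)) => [|y _].
  by rewrite sumr_const -[(a n x2) *+ _]mulr_natl mulKf ?card_mx_neq0.
by apply/esym/ai/hsim_block0l.
Qed.

Lemma hdel_deg0r (a : fun1) n (x1 : 'M[F]_n) (x2 : 'M[F]_0) :
  inv1 a -> hdel a x1 x2 = a n x1.
Proof.
move=> ai; rewrite /hdel (eq_bigr (fun=> a n x1)) => [|y _].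
  by rewrite sumr_const -[(a n x1) *+ _]mulr_natl mulKf ?card_mx_neq0.
by apply/esym/ai/hsim_block0r.
Qed.

Lemma hsim_deg0 m n (x : 'M[F]_m) (y : 'M[F]_n) : m = 0%N -> n = 0%N -> hsim x y.
Proof. by move=> em en; subst m n; rewrite [x]mx00 [y]mx00 hsim_refl. Qed.

Lemma quomx0_sim n (x : 'M[F]_n) : hsim x (quomx 0 x).
Proof.
have ad : adapted (0 : 'M[F]_(0, n)) 0 1%:M 1%:M.
  split; rewrite ?mulmx1 ?mul0mx ?add0r //.
  by rewrite [RHS]mx00.
have := adapted_quo ad (x := x); rewrite genmx0 !mul0mx mul1mx mulmx1.
exact.
Qed.

Lemma resmx1_sim n (x : 'M[F]_n) : hsim x (resmx 1%:M x).
Proof.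
have ad : adapted (1%:M : 'M[F]_n) 1%:M (0 : 'M[F]_(n, 0)) 0.
  split; rewrite ?mulmx1 ?mulmx0 ?addr0 //.
  by rewrite [LHS]mx00 [RHS]mx00.
have := adapted_res ad (x := x); rewrite genmx1 mulmx0 mul1mx mulmx1.
exact.
Qed.

(** The subspaces 0 and F^n give the two terms with a factor of degree 0; they are distinct because
    n is positive. *)
Lemma hmul_split (al : fun2) n (x : 'M[F]_n) (u : 'M[F]_0) :
  inv2 al -> (0 < n)%N ->
  hmul al x = al n 0%N x u + (al 0%N n u x + hmul (trunc al) x).
Proof.
move=> ai n0; rewrite /hmul.
have s0 : (<<0 : 'M[F]_n>>%MS == 0) && stablemx (0 : 'M[F]_n) x.
  by rewrite genmx0 eqxx mul0mx sub0mx.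
have s1 : (<<1%:M : 'M[F]_n>>%MS == 1%:M) && stablemx (1%:M : 'M[F]_n) x && ((1%:M : 'M[F]_n) != 0).
  by rewrite genmx1 eqxx submx1 -mxrank_eq0 mxrank1 -lt0n.
have r0 : \rank (0 : 'M[F]_n) = 0%N by rewrite mxrank0.
have r1 : \rank (cokermx (1%:M : 'M[F]_n)) = 0%N by rewrite mxrank_coker mxrank1 subnn.
have E (be : fun2) : \sum_(W : 'M[F]_n | (<<W>>%MS == W) && stablemx W x)
     be _ _ (quomx W x) (resmx W x) =
   be _ _ (quomx 0 x) (resmx 0 x) + (be _ _ (quomx 1%:M x) (resmx 1%:M x) +
   \sum_(W : 'M[F]_n | (<<W>>%MS == W) && stablemx W x && (W != 0) && (W != 1%:M))
     be _ _ (quomx W x) (resmx W x)).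
  by rewrite (bigD1 (0 : 'M[F]_n) s0) (bigD1 (1%:M : 'M[F]_n) s1).
rewrite !E; congr (_ + _).
  by apply: ai; [rewrite hsim_sym; apply: quomx0_sim | apply: hsim_deg0].
have t0 : trunc al (quomx 0 x) (resmx 0 x) = 0.
  by apply: trunc_reduced; rewrite negb_and -!leqNgt r0 orbT.
have t1 : trunc al (quomx 1%:M x) (resmx 1%:M x) = 0.
  by apply: trunc_reduced; rewrite negb_and -!leqNgt r1.
rewrite t0 t1 !add0r; congr (_ + _).
  by apply: ai; [apply: hsim_deg0 | rewrite hsim_sym; apply: resmx1_sim].
apply: eq_bigr => W /andP [/andP [/andP [/eqP cW _] W0] W1].
rewrite /trunc !lt0n (mxrank_eq0 W) W0 andbT ifT // mxrank_coker subn_eq0 -ltnNge.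
rewrite ltn_neqAle rank_leq_row andbT; apply: contra W1 => /eqP rW.
rewrite -cW -genmx1; apply/eqP/genmxP; rewrite submx1 sub1mx /row_full rW eqxx.
by [].
Qed.

End Extension.

(** * Recursion on the degree *)

Section Construction.
Variables (F : finFieldType) (K : numClosedFieldType) (c : nat -> K).
Local Notation fun1 := (fun1 F K).
Local Notation fun2 := (fun2 F K).
Local Notation kerfam := (kerfam F K).

(** Every function is primitive in degree 0, where [normalized] fixes the operator; the scalar is
    therefore prescribed only for n > 0. *)
Definition bialgebra_at (k : kerfam) n := [/\ comult_compat k n, mult_compat k n
  & (0 < n)%N -> scalar_on_primitives (c n) k n].

Lemma bialgebra_at_agree k k' n : agree k k' n -> bialgebra_at k n -> bialgebra_at k' n.
Proof.
move=> kk [kc km ks]; split.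
- exact: comult_compat_agree kc.
- exact: mult_compat_agree km.
- by move=> n0; apply: scalar_on_primitives_agree (ks n0).
Qed.

Definition bialgebra_below (k : kerfam) N :=
  [/\ inv_preserving k, normalized k & forall n, (n < N)%N -> bialgebra_at k n].

Definition idker : kerfam := fun n y x => (y == x)%:R.

Lemma app_idker (a : fun1) n (x : 'M[F]_n) : app idker a x = a n x.
Proof.
rewrite /app (bigD1 x) //= /idker eqxx mulr1 big1 ?addr0 // => y /negPf ->.
by rewrite mulr0.
Qed.

Lemma app2_idker (al : fun2) m n (x1 : 'M[F]_m) (x2 : 'M[F]_n) :
  app2 idker al x1 x2 = al m n x1 x2.
Proof. by rewrite /app2 app_idker app_idker. Qed.

Lemma bialgebra_below1 : bialgebra_below idker 1.
Proof.
split=> [a ai m n u v uv|y x|n].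
- by rewrite !app_idker (ai _ _ _ _ uv).
- by rewrite /idker [y]mx00 [x]mx00 eqxx.
rewrite ltnS leqn0 => /eqP ->; split=> //.
  move=> a ai n1 n2 _ x1 x2; rewrite app2_idker.
  by apply: hdel_ext => y; rewrite app_idker.
move=> al ai x; rewrite app_idker; apply: hmul_ext => a b q s _.
by rewrite app2_idker.
Qed.

Lemma bialgebra_below_step k N : (0 < N)%N -> bialgebra_below k N ->
  exists2 k', bialgebra_below k' N.+1 & agree k k' N.-1.
Proof.
move=> N0 [kp k0 kg].
have kc n (h : (n < N)%N) : comult_compat k n by case: (kg n h).
have km n (h : (n < N)%N) : mult_compat k n by case: (kg n h).
have [kN [kNa kNz]] := exists_kernel (c N) kp kc km.
(* Only degree N changes. At n = N [conform_mx] merely retypes its argument. *)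
pose k' : kerfam := fun n y x =>
  if n == N then kN (conform_mx 0 y) (conform_mx 0 x) else k n y x.
have kE n : n != N -> forall y x : 'M[F]_n, k' n y x = k n y x.
  by move=> nN y x; rewrite /k' (negPf nN).
have kNE (y x : 'M[F]_N) : k' N y x = kN y x by rewrite /k' eqxx !conform_mx_id.
have kk : agree k k' N.-1.
  by move=> m mN y x; rewrite kE // neq_ltn -[X in (_ < X)%N](prednK N0) ltnS mN.
exists k' => //.
have k'a (al : fun2) : inv2 al -> reduced al -> forall x : 'M[F]_N,
    app k' (hmul al) x = hmul (app2 k al) x.
  by move=> ai ap x; rewrite -kNa //; apply: eq_bigr => y _; rewrite kNE.
have k'z (z : fun1) : inv1 z -> primitive N z -> forall x : 'M[F]_N,
    app k' z x = c N * z N x.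
  by move=> ai ap x; rewrite -kNz //; apply: eq_bigr => y _; rewrite kNE.
have k'0 : normalized k' by move=> y x; rewrite kE ?k0 // neq_ltn N0.
(* All properties in degree N are checked on this splitting into a decomposable and a primitive
   part, on each of which [k'] is prescribed. *)
have dec (a : fun1) : inv1 a -> exists al : fun2, exists z : fun1,
    [/\ inv2 al, reduced al, inv1 z, primitive N z &
        (forall x : 'M[F]_N, a N x = hmul al x + z N x) /\
        (forall x : 'M[F]_N, app k' a x = hmul (app2 k al) x + c N * z N x)].
  move=> ai; have [e ez] := primitive_decomp N ai.
  set z : fun1 := fun n x => _ in ez.
  have zi : inv1 z.
    by move=> m n u v uv; rewrite /z (ai _ _ _ _ uv) (hmul_inv (comb_inv e) uv).
  have aE (x : 'M[F]_N) : a N x = hmul (comb e) x + z N x by rewrite addrC subrK.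
  exists (comb e), z; split; rewrite //; first exact: comb_inv.
    exact: comb_reduced.
  split=> // x; rewrite -k'z // -(k'a (comb e)) -?app_add.
  - exact: app_ext.
  - exact: comb_inv.
  - exact: comb_reduced.
have k'p : inv_preserving k'.
  move=> a ai m n u v uv; have e := hsim_dim uv; subst m.
  have [eN|nN] := eqVneq n N; last first.
    rewrite !(app_agree a (fun y => kE n nN y _)).
    exact: kp.
  subst n; have [al [z [ali alp zi _ [_ E]]]] := dec a ai.
  by rewrite !E (zi _ _ _ _ uv) (hmul_inv (app2_inv kp ali) uv).
have lt1 n1 n2 : (0 < n1)%N -> (0 < n2)%N -> (n1 + n2)%N = N -> n1 != N /\ n2 != N.
  move=> p1 p2 <-; split; rewrite neq_ltn.
    by rewrite -[X in (X < _)%N]addn0 ltn_add2l p2.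
  by rewrite -[X in (X < _)%N]add0n ltn_add2r p1.
have app2E (al : fun2) n1 n2 (x1 : 'M[F]_n1) (x2 : 'M[F]_n2) :
    (0 < n1)%N -> (0 < n2)%N -> (n1 + n2)%N = N -> app2 k' al x1 x2 = app2 k al x1 x2.
  move=> p1 p2 eN; have [d1 d2] := lt1 _ _ p1 p2 eN.
  by apply: app2_agree => y; apply: kE.
split=> // n; rewrite ltnS leq_eqVlt => /orP [/eqP ->|nN]; last first.
  apply: bialgebra_at_agree (kg n nN) => m mn.
  by apply: kk; rewrite (leq_trans mn) // -ltnS prednK.
split=> [a ai n1 n2 eN x1 x2|al ai x|_ z zi zp x]; last exact: k'z.
  case: n1 => [|n1] in eN x1 *.
    rewrite add0n in eN; subst n2; rewrite (hdel_deg0l _ _ (k'p _ ai)) /app2 app_deg0 //.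
    by apply: app_ext => y; rewrite hdel_deg0l.
  case: n2 => [|n2] in eN x2 *.
    rewrite addn0 in eN; subst N; rewrite (hdel_deg0r _ _ (k'p _ ai)).
    by apply: app_ext => y; rewrite app_deg0 // hdel_deg0r.
  have [al [z [ali alp zi zp [aE kaE]]]] := dec a ai.
  have hE (b : fun1) (d : fun1) (C : K) m1 m2 (y1 : 'M[F]_m1) (y2 : 'M[F]_m2) :
     hdel (fun n w => b n w + C * d n w) y1 y2 = hdel b y1 y2 + C * hdel d y1 y2.
    by rewrite /hdel big_split mulrDr /= -big_distrr /= mulrCA.
  (* The primitive part has no coproduct on either side; for the decomposable part the Mackey
     formula applies. *)
  transitivity (hdel (fun n w => hmul (app2 k al) w + c N * z n w) x1 x2).
    by apply: hdel_ext; rewrite eN => w; apply: kaE.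
  rewrite hE zp // mulr0 addr0 (hdel_hmul_app2 _ _ kp kc km) // app2E //.
  have -> : app2 k (hdel a) x1 x2 =
      app2 k (fun m n y1 y2 => hdel (fun n w => hmul al w + 1 * z n w) y1 y2) x1 x2.
    apply: app2_ext => y1 y2; apply: hdel_ext; rewrite eN => w.
    by rewrite mul1r aE.
  by apply: app2_ext => y1 y2; rewrite hE zp // mulr0 addr0.
pose u : 'M[F]_0 := 0.
rewrite (hmul_split _ u (app2_inv k'p ai)) //.
(* [conform_mx] makes the two terms with a factor of degree 0 into functions of all degrees, as
   [app] expects. *)
rewrite (@app_ext _ _ _ _ (fun n y => al N 0%N (conform_mx 0 y) u
   + (al 0%N N u (conform_mx 0 y) + hmul (trunc al) y))); last first.
  by move=> y; rewrite (hmul_split y u ai) // !conform_mx_id.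
rewrite app_add app_add k'a; [|exact: trunc_inv|exact: trunc_reduced].
congr (_ + (_ + _)).
- by apply: app_ext => y; rewrite conform_mx_id app_deg0.
- rewrite /app2 app_deg0 //.
  by apply: app_ext => y; rewrite conform_mx_id.
apply: hmul_ext => a b q s e; rewrite [RHS]/trunc.
case: ifP => [/andP [p1 p2]|np]; last first.
  by apply: app2_reduced (@trunc_reduced _ _ al) _ _ _ _ _; rewrite np.
by rewrite app2E //; apply: app2_ext => y z; rewrite /trunc p1 p2.
Qed.

Lemma exists_bialgebra_morphism :
  exists k : kerfam, [/\ inv_preserving k, normalized k & forall n, bialgebra_at k n].
Proof.
(* [cid] turns existence into data, so that the extensions can be iterated; agreement stays in the
   type to compare the stages later. *)
have st N (k : {k | bialgebra_below k N.+1}) :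
    {k' : {k' | bialgebra_below k' N.+2} | agree (sval k) (sval k') N}.
  apply: cid; case: (bialgebra_below_step (ltn0Sn N) (svalP k)) => k' k'g kk.
  by exists (exist _ k' k'g).
pose bld := nat_rect (fun N => {k | bialgebra_below k N.+1})
  (exist _ idker bialgebra_below1) (fun N k => sval (st N k)).
have bldS n : agree (sval (bld n)) (sval (bld n.+1)) n by exact: svalP (st n (bld n)).
have bldE m n : (m <= n)%N -> forall y x : 'M[F]_m, sval (bld n) m y x = sval (bld m) m y x.
  move=> mn y x; rewrite -(subnK mn); elim: (n - m)%N => // d IH.
  by rewrite addSn -IH -bldS // leq_addl.
(* Diagonal choice: later stages agree with stage n in all degrees up to n. *)
pose k : kerfam := fun n => sval (bld n) n.
have kk n : agree (sval (bld n)) k n by move=> m mn y x; rewrite bldE.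
exists k; split=> [a ai m n u v uv|y x|n].
- have e := hsim_dim uv; subst m; case: (svalP (bld n)) => kp _ _.
  rewrite -!(app_agree a (fun y => kk n n (leqnn n) y _)).
  exact: kp.
- by case: (svalP (bld 0)) => _ k0 _; apply: k0.
- by case: (svalP (bld n)) => _ _ kg; apply: bialgebra_at_agree (kk n) (kg n _).
Qed.

End Construction.

Local Opaque CC.

(** * Comparison with Harish-Chandra induction and pre-cuspidality *)

Section Extend.
Variable F : finFieldType.
Local Notation fun1 := (fun1 F CC).
Local Notation fun2 := (fun2 F CC).

Definition extend n (f : 'M[F]_n -> CC) : fun1 := fun m x =>
  if m == n then f (conform_mx 0 x) else 0.

Lemma extendE n (f : 'M[F]_n -> CC) x : extend f x = f x.
Proof. by rewrite /extend eqxx conform_mx_id. Qed.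

Lemma extend_neq n (f : 'M[F]_n -> CC) m (x : 'M[F]_m) : m != n -> extend f x = 0.
Proof. by move=> /negPf mn; rewrite /extend mn. Qed.

Lemma classfun_hsim n (f : 'M[F]_n -> CC) u v : classfun f -> hsim u v -> f u = f v.
Proof.
move=> fc /hsim_conjP [P [Q [PQ QP ->]]].
have Pu : P \in unitmx by case/mulmx1_unit: PQ.
by rewrite -[in RHS](fc P Pu) -[invmx P]mulmx1 -PQ mulKmx.
Qed.

Lemma extend_inv n (f : 'M[F]_n -> CC) : classfun f -> inv1 (extend f).
Proof.
move=> fc m p u v uv; have e := hsim_dim uv; subst p.
have [e|mn] := eqVneq m n; last by rewrite !extend_neq.
by subst m; rewrite !extendE; apply: classfun_hsim.
Qed.

Lemma inv1_classfun (a : fun1) n : inv1 a -> classfun (a n).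
Proof. by move=> ai g gu x; apply/ai/hsim_conj. Qed.

Definition tensor (a b : fun1) : fun2 := fun m n u v => a m u * b n v.

Lemma tensor_inv a b : inv1 a -> inv1 b -> inv2 (tensor a b).
Proof.
move=> ai bi m m' n n' u u' v v' uu vv.
by rewrite /tensor (ai _ _ _ _ uu) (bi _ _ _ _ vv).
Qed.

Lemma app2_tensor k a b m n (u : 'M[F]_m) (v : 'M[F]_n) :
  app2 k (tensor a b) u v = app k a u * app k b v.
Proof.
rewrite /app2 /tensor mulrC -app_scale; apply: app_ext => y.
by rewrite app_scale mulrC.
Qed.

Lemma adapted_basis_dim n r s (W : 'M[F]_n) :
  \rank W = r -> \rank (cokermx W) = s ->
  exists R : 'M[F]_(r, n), exists R', exists Q : 'M[F]_(n, s), exists T,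
    adapted R R' Q T /\ (R :=: W)%MS.
Proof.
move=> <- <-; exists (sub_in W), (sub_out W), (quo_in W), (quo_out W).
by split; [apply: adapted_sub_quo | apply: sub_in_eq].
Qed.

Section Induction.
Variables n1 n2 : nat.
Implicit Types g x W : 'M[F]_(n1 + n2).

(** The subspace is spanned by the last n2 rows of g: it is stable under x exactly when the
    conjugate of x by g lies in Lie P. *)
Lemma adapted_unitmx g : g \in unitmx ->
  adapted (dsubmx g) (rsubmx (invmx g)) (lsubmx (invmx g)) (usubmx g).
Proof.
move=> gu.
have e1 : row_mx (lsubmx (invmx g)) (rsubmx (invmx g)) *m
    col_mx (usubmx g) (dsubmx g) = 1%:M by rewrite hsubmxK vsubmxK mulVmx.
have e2 : col_mx (usubmx g) (dsubmx g) *m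
    row_mx (lsubmx (invmx g)) (rsubmx (invmx g)) = 1%:M by rewrite hsubmxK vsubmxK mulmxV.
move: e2; rewrite mul_col_row scalar_mx_block => /eq_block_mx [a b c d].
by split=> //; rewrite -e1 mul_row_col addrC.
Qed.

Lemma conj_block g x : g *m x *m invmx g =
  block_mx (usubmx g *m x *m lsubmx (invmx g)) (usubmx g *m x *m rsubmx (invmx g))
           (dsubmx g *m x *m lsubmx (invmx g)) (dsubmx g *m x *m rsubmx (invmx g)).
Proof.
by rewrite -mul_col_row -mul_col_mx vsubmxK hsubmxK.
Qed.

(** The invertible matrices whose last n2 rows span W form one coset of the parabolic, that of
    [col_mx T R]. *)
Lemma card_parabolic W : <<W>>%MS = W -> \rank W = n2 ->
  #|[pred g : 'M[F]_(n1 + n2) | (g \in unitmx) && (<<dsubmx g>>%MS == W)]| =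
  #|[set g : 'M[F]_(n1 + n2) | (g \in unitmx) && inLieP g]|.
Proof.
move=> cW rW; have cr : \rank (cokermx W) = n1 by rewrite mxrank_coker rW addnK.
have [R [R' [Q [T [ad RW]]]]] := adapted_basis_dim rW cr.
pose g0 := col_mx T R.
have g01 : g0 *m row_mx Q R' = 1%:M.
  have TR := adapted_TR' ad; case: ad => a b c d.
  by rewrite mul_col_row a b c TR -scalar_mx_block.
have gu : g0 \in unitmx by case/mulmx1_unit: g01.
rewrite -[RHS](card_image (can_inj (mulmxK gu))); apply: eq_card => g; rewrite [LHS]inE.
have key p : p \in unitmx -> (<<dsubmx (p *m g0)>>%MS == W) = inLieP p.
  move=> pu; rewrite -{1}[p]vsubmxK mul_col_mx col_mxKd.
  have E : (dsubmx p *m g0 <= R)%MS = inLieP p.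
    rewrite (adapted_sub ad) /inLieP -{1}[dsubmx p]hsubmxK mul_row_col mulmxDl -!mulmxA.
    case: ad => _ b c _; by rewrite b c mulmx1 mulmx0 addr0.
  rewrite -E -cW; apply/eqP/idP => [/genmxP/eqmxP h|h].
    by rewrite h RW.
  have fr : row_free (dsubmx p *m g0).
    apply/row_freeP; exists (invmx g0 *m rsubmx (invmx p)).
    by rewrite mulmxA mulmxK //; case: (adapted_unitmx pu).
  apply/genmxP; rewrite -(geq_leqif (mxrank_leqif_eq _)) -?RW //.
  by rewrite (eqP fr) rank_leq_row.
apply/andP/imageP => [[gu' /eqP gW]|[p]].
  exists (g *m invmx g0); last by rewrite mulmxKV.
  have pu : g *m invmx g0 \in unitmx by rewrite unitmx_mul gu' unitmx_inv.
  by rewrite inE pu -key // mulmxKV // gW eqxx.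
rewrite inE => /andP [pu pP] ->; split; first by rewrite unitmx_mul pu.
by rewrite key.
Qed.

(** Grouping the g by the span W of their last n2 rows, the summand depends only on W and each group
    has as many elements as the parabolic. Subspaces of other dimensions contribute 0 because
    [extend f2] vanishes there. *)
Lemma HCindE (f1 : 'M[F]_n1 -> CC) (f2 : 'M[F]_n2 -> CC) x :
  classfun f1 -> classfun f2 ->
  HCind f1 f2 x = hmul (tensor (extend f1) (extend f2)) x.
Proof.
move=> c1 c2; have ti := tensor_inv (extend_inv c1) (extend_inv c2).
rewrite /HCind; set cP := (X in X%:R^-1); set tn := tensor _ _ in ti *.
pose P W := [&& <<W>>%MS == W, stablemx W x & \rank W == n2].
have sP g : g \in unitmx -> inLieP (g *m x *m invmx g) = stablemx <<dsubmx g>>%MS x.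
  move=> gu; rewrite (adapted_stable (adapted_unitmx gu)).
  by rewrite /inLieP conj_block block_mxKdl.
have rg g : g \in unitmx -> \rank <<dsubmx g>>%MS = n2.
  by move=> gu; rewrite mxrank_gen; apply/eqP; apply: adapted_free (adapted_unitmx gu).
rewrite (partition_big (fun g => <<dsubmx g>>%MS) P) /=; last first.
  by move=> g /andP [gu]; rewrite sP // /P genmx_id eqxx rg // eqxx => ->.
have cP0 : (cP%:R : CC) != 0.
  rewrite pnatr_eq0 -lt0n; apply/card_gt0P; exists 1%:M.
  by rewrite inE unitmx1 /inLieP scalar_mx_block block_mxKdl eqxx.
rewrite (eq_bigr (fun W => cP%:R * tn _ _ (quomx W x) (resmx W x))); last first.
  move=> W /and3P [/eqP cW st /eqP rW].
  rewrite (eq_bigr (fun=> tn _ _ (quomx W x) (resmx W x))).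
    rewrite (eq_bigl (fun g => g \in [pred g | (g \in unitmx) && (<<dsubmx g>>%MS == W)])).
      by rewrite sumr_const card_parabolic // mulr_natl.
    move=> g; rewrite inE; case: (boolP (g \in unitmx)) => //= gu; rewrite sP //.
    by case: eqP => [->|_]; rewrite ?st ?andbF.
  move=> g /andP [/andP [gu gP] /eqP gW].
  have st0 : dsubmx g *m x *m lsubmx (invmx g) = 0.
    by apply/eqP; rewrite -(adapted_stable (adapted_unitmx gu)) -sP.
  have q := adapted_quo (adapted_unitmx gu) st0.
  have r := adapted_res (adapted_unitmx gu) st0.
  rewrite gW in q; rewrite gW in r.
  rewrite -(ti _ _ _ _ _ _ _ _ q r) /tn /tensor !extendE conj_block.
  by rewrite block_mxKul block_mxKdr.
rewrite -big_distrr /= mulrA mulVf // mul1r /hmul.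
rewrite [RHS](bigID (fun W => \rank W == n2)) /= [X in _ = _ + X]big1 ?addr0.
  by apply: eq_bigl => W; rewrite /P andbA.
by move=> W /andP [_ rW]; rewrite /tn /tensor (extend_neq f2) ?mulr0.
Qed.

End Induction.

Lemma primitive_precuspidal n (f : 'M[F]_n -> CC) :
  precuspidal f -> primitive n (extend f).
Proof.
move=> pf n1 n2 p1 p2 eN x1 x2; subst n.
(* The two-block composition (n1, n2), with the boolean read as block index 0 or 1. *)
pose blk (i : 'I_(n1 + n2)) : nat := (n1 <= i)%N.
have sb : std_block blk.
  move=> i j ij; rewrite /blk; case: (leqP n1 i) => // h.
  by rewrite (leq_trans h ij).
have pb : proper_block blk.
  exists (lshift n2 (Ordinal p1)), (rshift n1 (Ordinal p2)).
  by rewrite /blk /= leqNgt p1 leq_addr.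
have xL : inLieL blk (block_mx x1 0 0 x2).
  apply/forallP => i; apply/forallP => j; apply/implyP; rewrite /blk.
  rewrite -[ i]splitK -[j]splitK; case: (split i) => i'; case: (split j) => j' /=;
    rewrite ?leq_addr ?(leqNgt n1) ?ltn_ord //= => _.
    by rewrite block_mxEur mxE.
  by rewrite block_mxEdl mxE.
have bl i : blk (lshift n2 i) = 0%N by rewrite /blk /= leqNgt ltn_ord.
have br i : blk (rshift n1 i) = 1%N by rewrite /blk /= leq_addr.
have uE (y : 'M[F]_(n1 + n2)) : inLieU blk y = (block_mx 0 (ursubmx y) 0 0 == y).
  apply/forallP/eqP => [h|<- i].
    have H i j : ~~ (blk i < blk j)%N -> y i j = 0.
      by move=> b; have /forallP /(_ j) /implyP /(_ b) /eqP := h i.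
    apply/matrixP => i j; rewrite -[ i]splitK -[j]splitK.
    case: (split i) => i'; case: (split j) => j' /=.
    - by rewrite block_mxEul mxE H // !bl.
    - by rewrite block_mxEur !mxE.
    - by rewrite block_mxEdl mxE H // bl br.
    - by rewrite block_mxEdr mxE H // !br.
  apply/forallP => j; apply/implyP; rewrite -[ i]splitK -[j]splitK.
  case: (split i) => i'; case: (split j) => j' /=;
    rewrite ?block_mxEul ?block_mxEur ?block_mxEdl ?block_mxEdr ?bl ?br //= => _;
    by rewrite mxE.
have := pf blk 1%:M sb pb (unitmx1 _ _) _ xL; rewrite /HCres.
rewrite (reindex_onto (fun w : 'M[F]_(n1, n2) => block_mx 0 w 0 0) ursubmx) /=; last first.
  by move=> y; rewrite uE => /eqP.
move/eqP; rewrite mulf_eq0 invr_eq0 pnatr_eq0 => /orP [/eqP /card0_eq/(_ 0)|/eqP].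
  by rewrite inE uE -block_mx0 block_mxKur eqxx.
move=> e; rewrite /hdel -[RHS](mulr0 (#|{: 'M[F]_(n1, n2)}|%:R^-1)); congr (_ * _).
apply: etrans e; apply: eq_big => [w|w _]; first by rewrite uE block_mxKur !eqxx.
by rewrite extendE invmx1 mulmx1 mul1mx add_block_mx !addr0 add0r.
Qed.

(** A proper standard parabolic lies in a maximal one: the cut is at the first index whose block
    exceeds that of a suitable [i0]. *)
Lemma block_cut n (blk : 'I_n -> nat) : std_block blk -> proper_block blk ->
  exists n1 n2, [/\ (0 < n1)%N, (0 < n2)%N, (n1 + n2)%N = n &
    forall i j : 'I_n, (i < n1)%N -> (n1 <= j)%N -> (blk i < blk j)%N].
Proof.
move=> sb [i0 [j0 ij]].
wlog lt : i0 j0 ij / (blk i0 < blk j0)%N.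
  move=> h; have [l|l|e] := ltngtP (blk i0) (blk j0).
  - exact: h ij l.
  - by apply: h l; rewrite eq_sym.
  - by rewrite e eqxx in ij.
have ex : exists m, [exists j : 'I_n, (j == m :> nat) && (blk i0 < blk j)%N].
  by exists j0; apply/existsP; exists j0; rewrite eqxx.
case: (ex_minnP ex) => m /existsP [j /andP [/eqP jm bj]] mmin; subst m.
have i0j : (i0 < j)%N.
  by rewrite ltnNge; apply: contraL bj => h; rewrite -leqNgt; apply: sb.
exists (j : nat), (n - j)%N; split.
- exact: leq_ltn_trans i0j.
- by rewrite subn_gt0.
- by rewrite subnKC // ltnW.
move=> i k ij1 jk; apply: leq_ltn_trans (leq_trans bj (sb _ _ jk)).
rewrite leqNgt; apply: contraL ij1 => h; rewrite -leqNgt; apply: mmin.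
by apply/existsP; exists i; rewrite eqxx.
Qed.

(** Transitivity of restriction: the radical contains that of the maximal parabolic of [block_cut],
    so the sum is unchanged by the translations [V w]. Summing over w turns each term into a
    multiple of a value of [hdel], which is 0. *)
Lemma precuspidal_primitive n (f : 'M[F]_n -> CC) :
  classfun f -> primitive n (extend f) -> precuspidal f.
Proof.
move=> fc fp blk g sb pb gu x xL.
have [n1 [n2 [p1 p2 eN cut]]] := block_cut sb pb; subst n.
rewrite /HCres; under eq_bigr do rewrite fc //.
set S := (\sum_(y | _) _); suff -> : S = 0 by rewrite mulr0.
pose V (w : 'M[F]_(n1, n2)) : 'M[F]_(n1 + n2) := block_mx 0 w 0 0.
have VU w y : inLieU blk (y + V w) = inLieU blk y.
  apply/forallP/forallP => h i; apply/forallP => j; apply/implyP => b;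
    have /forallP /(_ j) /implyP /(_ b) := h i; rewrite mxE;
    (suff -> : V w i j = 0 by rewrite addr0);
    move: b; rewrite -[ i]splitK -[j]splitK;
    case: (split i) => i'; case: (split j) => j' /=;
    rewrite /V ?block_mxEul ?block_mxEur ?block_mxEdl ?block_mxEdr ?mxE //;
    by rewrite cut //= ?ltn_ord ?leq_addr.
have SV w : S = \sum_(y | inLieU blk y) f (x + (y + V w)).
  rewrite /S (reindex_inj (addIr (V w))); apply: eq_bigl => y; exact: VU.
have xyE y : inLieU blk y -> dlsubmx (x + y) = 0.
  move=> yU; apply/matrixP => i j; rewrite !mxE.
  have ij : (blk (lshift n2 j) < blk (rshift n1 i))%N.
    by rewrite cut //= ?ltn_ord ?leq_addr.
  have /forallP /(_ (rshift n1 i)) /forallP /(_ (lshift n2 j)) /implyP h1 := xL.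
  have /forallP /(_ (rshift n1 i)) /forallP /(_ (lshift n2 j)) /implyP h2 := yU.
  rewrite (eqP (h1 _)) ?(eqP (h2 _)) ?addr0 //; first by rewrite -leqNgt ltnW.
  by rewrite neq_ltn ij orbT.
have : \sum_(w : 'M[F]_(n1, n2)) S = 0.
  rewrite (eq_bigr _ (fun w _ => SV w)) exchange_big big1 //= => y yU.
  have h := fp n1 n2 p1 p2 erefl (ulsubmx (x + y)) (drsubmx (x + y)).
  move/eqP: h; rewrite /hdel mulf_eq0 invr_eq0 (negPf (card_mx_neq0 _ _ _ _)) /= => /eqP h.
  apply: etrans h; rewrite [RHS](reindex_inj (addrI (ursubmx (x + y)))).
  apply: eq_bigr => w _; rewrite extendE addrA -{1}[x + y]submxK xyE // /V.
  by rewrite add_block_mx !addr0.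
rewrite sumr_const => /eqP; rewrite -mulr_natl mulf_eq0 (negPf (card_mx_neq0 _ _ _ _)).
by move/eqP.
Qed.

End Extend.

(** * Uniqueness of the family *)

Section Uniqueness.
Variable F : finFieldType.
Local Notation family := (forall n : nat, ('M[F]_n -> CC) -> ('M[F]_n -> CC)).

Lemma family_sum (D : family) n : is_endo_family D ->
  forall (I : Type) (r : seq I) (e : I -> CC) (A : I -> 'M[F]_n -> CC) z,
  (forall i, classfun (A i)) -> classfun z -> forall x,
  D n (fun x => \sum_(i <- r) e i * A i x + z x) x =
  \sum_(i <- r) e i * D n (A i) x + D n z x.
Proof.
move=> De I r e A z Ac zc x; have [_ lin] := De n.
elim: r => [|i r IH].
  rewrite big_nil add0r; congr (D n _ x).
  by apply: funext => w; rewrite big_nil add0r.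
rewrite big_cons -addrA -IH -lin //.
  by congr (D n _ x); apply: funext => w; rewrite big_cons addrA.
move=> g gu w; rewrite zc //; congr (_ + _).
by apply: eq_bigr => j _; rewrite Ac.
Qed.

Lemma D_props_unique (D D' : family) : D_props D -> D_props D' ->
  forall n (f : 'M[F]_n -> CC), classfun f -> forall x, D n f x = D' n f x.
Proof.
move=> [De [D0 [Dm Dp]]] [De' [D0' [Dm' Dp']]] n.
elim/ltn_ind: n => n IH f fc x.
have [n0|n0] := posnP n; first by subst n; rewrite D0 // D0'.
(* Linearity is stated for a * f + h; the case a = -1, f = h = 0 gives the value at the zero
   function. *)
have D00 (E : family) : is_endo_family E -> E n (fun=> 0) x = 0.
  move=> Ee; have [_ lin] := Ee n.
  have c0 : classfun (fun _ : 'M[F]_n => 0 : CC) by [].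
  have := lin (-1) _ _ c0 c0 x; rewrite [X in _ = X + _]mulN1r [RHS]addNr => h; apply: etrans h.
  by congr (E n _ x); apply: funext => w; rewrite mulr0 addr0.
have prod n1 n2 (f1 : 'M[F]_n1 -> CC) (f2 : 'M[F]_n2 -> CC) :
    (0 < n1)%N -> (0 < n2)%N -> (n1 + n2)%N = n -> classfun f1 -> classfun f2 ->
    D n (fun y => hmul (tensor (extend f1) (extend f2)) y) x =
    D' n (fun y => hmul (tensor (extend f1) (extend f2)) y) x.
  move=> p1 p2 eN c1 c2; subst n.
  have -> : (fun y => hmul (tensor (extend f1) (extend f2)) y) = HCind f1 f2.
    by apply: funext => y; rewrite HCindE.
  have l1 : (n1 < n1 + n2)%N by rewrite -[X in (X < _)%N]addn0 ltn_add2l.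
  have l2 : (n2 < n1 + n2)%N by rewrite -[X in (X < _)%N]add0n ltn_add2r.
  rewrite Dm // Dm' //; congr (HCind _ _ x); apply: funext => y; exact: IH.
(* In degree n a product of two atoms is either induced from smaller positive degrees, where the
   induction hypothesis applies, or zero. *)
have atE (st : sqmx F n * sqmx F n) : D n (fun y => hmul (atom2 CC st) y) x = D' n (fun y => hmul (atom2 CC st) y) x.
  case: st => s t; pose m1 : nat := tag s; pose m2 : nat := tag t.
  pose f1 (u : 'M[F]_m1) := atom CC s u; pose f2 (u : 'M[F]_m2) := atom CC t u.
  have aE (r : sqmx F n) a (q : 'M[F]_a) :
      atom CC r q = extend (fun u : 'M[F]_(tag r) => atom CC r u) q.
    have [e|ne] := eqVneq a (tag r); first by subst a; rewrite extendE.
    rewrite extend_neq // /atom; case: ifP => // /hsim_dim e.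
    by rewrite e eqxx in ne.
  have [/and3P [p1 p2 /eqP eN]|np] := boolP [&& 0 < m1, 0 < m2 & m1 + m2 == n]%N.
    have E : (fun y : 'M[F]_n => hmul (atom2 CC (s, t)) y) =
        (fun y => hmul (tensor (extend f1) (extend f2)) y).
      apply: funext => y; apply: hmul_ext => a b q w _.
      rewrite /atom2 /trunc /tensor /= (aE s _ q) (aE t _ w).
      case: ifP => // /negbT; rewrite negb_and => /orP [h|h].
        by rewrite [extend f1 q]extend_neq ?mul0r //; apply: contraNneq h => ->.
      by rewrite [extend f2 w]extend_neq ?mulr0 //; apply: contraNneq h => ->.
    have c1 : classfun f1 by exact: inv1_classfun (atom_inv CC s).
    have c2 : classfun f2 by exact: inv1_classfun (atom_inv CC t).
    by rewrite E; exact: prod p1 p2 eN c1 c2.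
  have -> : (fun y : 'M[F]_n => hmul (atom2 CC (s, t)) y) = (fun=> 0).
    apply: funext => y; rewrite (hmul_ext (be := fun _ _ _ _ => 0)) ?big1 //.
      by rewrite /hmul big1.
    move=> a b q w eN; rewrite /atom2 /trunc /= (aE s _ q) (aE t _ w).
    case: ifP => // /andP [a0 b0].
    have [ea|na] := eqVneq a m1; last by rewrite extend_neq ?mul0r.
    have [eb|nb] := eqVneq b m2; last by rewrite [X in _ * X]extend_neq ?mulr0.
    by case/and3P: np; rewrite -ea -eb a0 b0 eN.
  by rewrite !D00.
have [e ez] := primitive_decomp n (extend_inv fc).
set z : fun1 F CC := fun n x => _ in ez.
have zi : inv1 z.
  move=> m p u v uv.
  by rewrite /z (extend_inv fc uv) (hmul_inv (comb_inv e) uv).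
have zc : classfun (z n) by exact: inv1_classfun.
have zp : precuspidal (z n).
  apply: precuspidal_primitive => // n1 n2 p1 p2 eN x1 x2.
  rewrite -(ez n1 n2 p1 p2 eN x1 x2); apply: hdel_ext => y.
  by subst n; rewrite extendE.
have fE : f = (fun y => \sum_st e st * hmul (atom2 CC st) y + z n y).
  by apply: funext => y; rewrite /z extendE hmul_comb addrC subrK.
have ac (st : sqmx F n * sqmx F n) : classfun (fun y : 'M[F]_n => hmul (atom2 CC st) y).
  exact/inv1_classfun/hmul_inv/atom2_inv.
rewrite fE !(@family_sum _ n) // Dp // Dp' //; congr (_ + _).
by apply: eq_bigr => st _; rewrite atE.
Qed.

End Uniqueness.

Theorem mainTheorem10 (F : finFieldType) :
  exists D : forall n : nat, ('M[F]_n -> CC) -> ('M[F]_n -> CC),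
    D_props D /\
    (forall D' : forall n : nat, ('M[F]_n -> CC) -> ('M[F]_n -> CC),
       D_props D' ->
       forall (n : nat) (f : 'M[F]_n -> CC), classfun f ->
         forall x, D' n f x = D n f x).
Proof.
(* The scalars are imposed for n > 0, where [n.-1] is truly n - 1. *)
have [k [kp k0 kg]] := exists_bialgebra_morphism F (fun n => (-1) ^+ n.-1 : CC).
pose D n (f : 'M[F]_n -> CC) (x : 'M[F]_n) : CC := app k (extend f) x.
have Dc n (f : 'M[F]_n -> CC) : classfun f -> classfun (D n f).
  by move=> fc; apply/inv1_classfun/kp/extend_inv.
have DP : D_props D; last first.
  by exists D; split=> // D' DP'; apply: D_props_unique.
split; [|split; [|split]].
- move=> n; split; first exact: Dc.
  move=> a f h _ _ x; rewrite /D -app_scale -app_add; apply: app_ext => y.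
  by rewrite !extendE.
- by move=> f fc x; rewrite /D app_deg0 // extendE.
- move=> n1 n2 p1 p2 f1 f2 c1 c2 x; rewrite (HCindE _ (Dc _ _ c1) (Dc _ _ c2)).
  have [_ km _] := kg (n1 + n2)%N.
  have ti := tensor_inv (extend_inv c1) (extend_inv c2).
  rewrite /D (@app_ext _ _ _ _ (hmul (tensor (extend f1) (extend f2)))); last first.
    by move=> y; rewrite extendE HCindE.
  rewrite km //; apply: hmul_ext => a b q s _; rewrite app2_tensor /tensor.
  (* Operators respect the degree, so both sides vanish when m differs from n. *)
  have E n (f : 'M[F]_n -> CC) m (u : 'M[F]_m) :
      app k (extend f) u = extend (fun y : 'M[F]_n => app k (extend f) y) u.
    have [e|ne] := eqVneq m n; first by subst m; rewrite extendE.
    by rewrite [RHS]extend_neq // app0 // => y; rewrite extend_neq.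
  by congr (_ * _); apply: E.
- move=> n n0 f fc fp x; have [_ _ ks] := kg n.
  by rewrite /D (ks n0 _ (extend_inv fc) (primitive_precuspidal fp)) extendE.
Qed.
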